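(* Let $a,b,c,d,u_0,\omega_0\in\mathbb{R}$ with $b\neq 0$, and let $f\in L^2(\mathbb{R})$ be infinitely differentiable. Then $[-\gamma|b|,\gamma|b|]$ is the compact support of $\mathcal{O}^M f$ if and only if $\Delta_x^n f\in L^2(\mathbb{R})$ and $\left(\frac{u}{b}\right)^n(\mathcal{O}^M f)(u)\in L^2(\mathbb{R})$ for all $n\in\mathbb{Z}_+$, with $$\lim_{n\to\infty}\|\Delta_x^n f\|_2^{1/n}=\gamma,$$ where $$\gamma=\sup\left\{\left|\tfrac{u}{b}\right| : (\mathcal{O}^M f)(u)\neq 0,\ u\in\mathbb{R}\right\}.$$
   Context: For real parameters $M=\{a,b,c,d,u_0,\omega_0\}$ with $b\ne 0$, the offset linear canonical transform (OLCT) is defined for $f\in L^1(\mathbb{R})\cap L^2(\mathbb{R})$ by $$(\mathcal{O}^M f)(u)=\int_{\mathbb{R}}\mathcal{K}_M(u,x)f(x)\,dx,\qquad \mathcal{K}_M(u,x)=\sqrt{\tfrac{1}{2\pi i b}}\;e^{\frac{i}{2b}du_0^2}\,e^{\frac{i}{2b}\left(ax^2+2x(u_0-u)-2u(du_0-b\omega_0)+du^2\right)},$$ and it is also used for functions in $L^2(\mathbb{R})$, where it preserves the $L^2$ inner product. The operator $\Delta_x$ is $$\Delta_x=-\left(\frac{\partial}{\partial x}+\frac{i}{b}(ax+u_0)\right),$$ $\Delta_x^n$ is its $n$-th power, and $\|\cdot\|_2$ is the $L^2(\mathbb{R})$ norm.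
   Formalization: ''Is the compact support'' is read as: γ is finite, equals the (essential) supremum, and the support lies in [-γ|b|,γ|b|]; literal equality fails in the converse, e.g. when the transform is a smooth bump supported on [1,2] with b = 1. *)

(* Defs.v *)
From HB Require Import structures.
From mathcomp Require Import all_boot all_order all_algebra.
From mathcomp Require Import complex.
From mathcomp Require Import all_classical all_reals all_analysis.
From mathcomp Require Import ess_sup_inf.

Set Implicit Arguments.
Unset Strict Implicit.
Unset Printing Implicit Defensive.

Import Order.TTheory GRing.Theory Num.Theory.
Import numFieldNormedType.Exports.

Local Open Scope classical_set_scope.
Local Open Scope ring_scope.
Local Open Scope complex_scope.

(** Complex-valued functions of a real variable, measured, integrated and
    differentiated through their real and imaginary parts. *)

Section complex_valued.
Variable R : realType.
Implicit Types (f g : R -> R[i]) (p : R).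

Definition re f : R -> R := fun x => complex.Re (f x).
Definition im f : R -> R := fun x => complex.Im (f x).

(** [e^(it)] *)
Definition expi (t : R) : R[i] := cos t +i* sin t.

Definition Cintegral f : R[i] :=
  Rintegral (@lebesgue_measure R) setT (re f) +i*
  Rintegral (@lebesgue_measure R) setT (im f).

Definition LnormC p f : \bar R :=
  Lnorm (@lebesgue_measure R) p%:E (fun x => (Normc.normc (f x))%:E).

Definition inL p f : Prop :=
  [/\ measurable_fun setT (re f),
      measurable_fun setT (im f) &
      (LnormC p f < +oo)%E].

Definition smooth f : Prop :=
  forall n (x : R), derivable (derive1n n (re f)) x 1 /\
                    derivable (derive1n n (im f)) x 1.

Definition Cderive f : R -> R[i] :=
  fun x => derive1 (re f) x +i* derive1 (im f) x.

(** Closed support of an almost-everywhere class: the complement of the largest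
    open set on which [g] vanishes almost everywhere. *)
Definition ess_support g : set R :=
  [set u | forall V : set R, nbhs u V ->
     ~ {ae @lebesgue_measure R, forall x, V x -> g x = 0}].

End complex_valued.

Record olct_param (R : realType) := OLCTParam {
  pa : R; pb : R; pc : R; pd : R; pu0 : R; pw0 : R }.

Section olct.
Variables (R : realType) (M : olct_param R).
Local Notation a := (pa M).
Local Notation b := (pb M).
Local Notation d := (pd M).
Local Notation u0 := (pu0 M).
Local Notation w0 := (pw0 M).
Implicit Types (f g : R -> R[i]).

(** [sqrtc] is the principal branch of the square root. *)
Definition olct_kernel (u x : R) : R[i] :=
  sqrtc (1 / (0 +i* (2 * pi * b))) *
  expi ((2 * b)^-1 * (d * u0 ^+ 2)) *
  expi ((2 * b)^-1 * (a * x ^+ 2 + 2 * x * (u0 - u)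
                      - 2 * u * (d * u0 - b * w0) + d * u ^+ 2)).

Definition olct_integral f : R -> R[i] :=
  fun u => Cintegral (fun x => olct_kernel u x * f x).

(** [is_olct f g] means that [g] is a representative of the transform of
    [f] in L^2.  The transform is the continuous extension to L^2 of the
    integral transform on the dense subspace of functions both in L^1 and in
    L^2, so its graph is the L^2-closure of the graph of the latter. *)
Definition is_olct f g : Prop :=
  [/\ inL 2 f, inL 2 g &
      exists h : nat -> R -> R[i],
        [/\ forall k, inL 1 (h k) /\ inL 2 (h k),
            LnormC 2 (fun x => h k x - f x) @[k --> \oo] --> 0%E &
            LnormC 2 (fun u => olct_integral (h k) u - g u) @[k --> \oo]
              --> 0%E]].

Definition Delta f : R -> R[i] :=
  fun x => - (Cderive f x + (0 +i* (b^-1 * (a * x + u0))) * f x).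

(** The supremum of [|u / b|] over the points where [g] does not vanish, read
    essentially because [g] is only determined almost everywhere.  It is [0]
    when [g] vanishes almost everywhere and may be [+oo]. *)
Definition olct_radius g : \bar R :=
  ess_sup (@lebesgue_measure R)
    (fun u => (if g u != 0 then `|u / b| else 0)%:E).

End olct.

(* Main.v *)
Require Import Defs.
From mathcomp Require Import all_boot all_order all_algebra.
From mathcomp Require Import complex ring lra.
From mathcomp Require Import all_classical all_reals all_analysis.
From mathcomp Require Import measurable_realfun ess_sup_inf.

(* With [s = - 1 / b] the kernel factors as [C p(x) q(u) exp (i s x u)] with
   [|p| = |q| = 1], so up to the chirps [p], [q] the transform is a Fourier
   transform and [Delta] is the derivative: if [G] is the Fourier transform of
   [F = C p f], then [Delta^n f] has the modulus of [F^(n)] up to a constant.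
   When all the moments [u^n G] are in L^2 they are also in L^1; testing the
   multiplication formula against [exp (- i s x v - e |v|)], whose transform is
   a Poisson kernel, gives [K F(x) = int exp (- i s x v) G(v) dv] as [e] tends
   to 0.  This may be differentiated under the integral sign.  Bessel's
   inequality (again by Poisson kernels) puts the derivatives in L^2, and
   testing against the conjugate of [v^(2n) G], followed by [n] integrations by
   parts, yields [norm2 F^(n) = k * norm2 (s^n v^n G)] with [k] independent of
   [n].  Finally the [n]-th roots of the weighted norms [norm2 ((u / b)^n g)]
   tend to the essential supremum of [|u / b|] over [g <> 0]. *)

Set Implicit Arguments.
Unset Strict Implicit.
Unset Printing Implicit Defensive.

Import Order.TTheory GRing.Theory Num.Theory.
Import numFieldNormedType.Exports.
Local Open Scope classical_set_scope.
Local Open Scope ring_scope.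
Local Open Scope complex_scope.

(** The transform on L^2 is given only as a limit of integrals and [g] only almost everywhere,
    whereas [Delta] is a pointwise derivative of the given [f]. The proof therefore avoids
    manipulating the L^2 transform itself: it passes to the weak pairing [fourier_pair], and
    recovers from it an identity valid at every point, continuity of [f] being what excludes
    exceptional points. Only an everywhere identity can be differentiated again and again.

    Most constants are not sharp. Bounding real and imaginary parts separately costs a factor 2,
    which is harmless in Bessel's inequality and in error terms. The one exact identity, that for
    the norms, comes from an equality of integrals rather than from an estimate; its constant is
    independent of [n], so its [n]-th root tends to 1.

    In the converse direction the radius could a priori be infinite, so the limit is used to bound
    it from above, after which the direct part and uniqueness of limits give equality. *)

(** * Complex numbers and complex-valued integrals *)

Section complex_numbers.
Context {R : realType}.
Implicit Types (z w : R[i]) (x y : R).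
Local Notation normc := Normc.normc.

Lemma Re_addc z w : complex.Re (z + w) = complex.Re z + complex.Re w.
Proof. by case: z; case: w. Qed.

Lemma Im_addc z w : complex.Im (z + w) = complex.Im z + complex.Im w.
Proof. by case: z; case: w. Qed.

Lemma Re_oppc z : complex.Re (- z) = - complex.Re z.
Proof. by case: z. Qed.

Lemma Im_oppc z : complex.Im (- z) = - complex.Im z.
Proof. by case: z. Qed.

Lemma Re_mulc z w :
  complex.Re (z * w) = complex.Re z * complex.Re w - complex.Im z * complex.Im w.
Proof. by case: z; case: w. Qed.

Lemma Im_mulc z w :
  complex.Im (z * w) = complex.Re z * complex.Im w + complex.Im z * complex.Re w.
Proof. by case: z; case: w. Qed.

Lemma Re_conjc z : complex.Re (conjc z) = complex.Re z.
Proof. by case: z. Qed.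

Lemma Im_conjc z : complex.Im (conjc z) = - complex.Im z.
Proof. by case: z. Qed.

Lemma complex_ext z w :
  complex.Re z = complex.Re w -> complex.Im z = complex.Im w -> z = w.
Proof. by case: z; case: w => /= ? ? ? ? -> ->. Qed.

Lemma normc_sqr z : normc z ^+ 2 = complex.Re z ^+ 2 + complex.Im z ^+ 2.
Proof. by case: z => x y /=; rewrite sqr_sqrtr// addr_ge0// sqr_ge0. Qed.

Lemma normc_ge0 z : 0 <= normc z.
Proof. by case: z => x y /=; rewrite sqrtr_ge0. Qed.

Lemma normcJ_real z : normc (conjc z) = normc z.
Proof. by case: z => x y /=; rewrite sqrrN. Qed.

Lemma normc_real x : normc x%:C = `|x|.
Proof. by rewrite /= expr0n/= addr0 sqrtr_sqr. Qed.

Lemma normc_eq0 z : (normc z == 0) = (z == 0).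
Proof. by apply/eqP/eqP => [/Normc.eq0_normc//|->]; exact: Normc.normc0. Qed.

Lemma ler_Re_normc z : `|complex.Re z| <= normc z.
Proof.
by case: z => x y /=; rewrite -sqrtr_sqr ler_wsqrtr// lerDl sqr_ge0.
Qed.

Lemma ler_Im_normc z : `|complex.Im z| <= normc z.
Proof.
by case: z => x y /=; rewrite -sqrtr_sqr ler_wsqrtr// lerDr sqr_ge0.
Qed.

Lemma ler_normc_ReIm z : normc z <= `|complex.Re z| + `|complex.Im z|.
Proof.
rewrite -ler_sqr ?nnegrE ?addr_ge0 ?normc_ge0// normc_sqr sqrrD.
by rewrite !real_normK ?num_real// -addrA lerD2l lerDr mulrn_wge0// mulr_ge0.
Qed.

Lemma mulJc z : conjc z * z = (normc z ^+ 2)%:C.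
Proof.
rewrite normc_sqr; case: z => x y; apply: complex_ext => /=; ring.
Qed.

Lemma conjcM z w : conjc (z * w) = conjc z * conjc w.
Proof. exact: rmorphM. Qed.

Lemma real_complexM x y : (x * y)%:C = x%:C * y%:C.
Proof. exact: rmorphM. Qed.

Lemma normcX z n : normc (z ^+ n) = normc z ^+ n.
Proof.
by elim: n => [|n IH]; rewrite ?Normc.normc1// !exprS Normc.normcM IH.
Qed.

Lemma expiD x y : expi (x + y) = expi x * expi y.
Proof. by apply: complex_ext; rewrite /= ?cosD ?sinD//; ring. Qed.

Lemma expi0 : expi (0 : R) = 1.
Proof. by rewrite /expi cos0 sin0. Qed.

Lemma conjc_expi x : conjc (expi x) = expi (- x).
Proof. by rewrite /expi /= cosN sinN. Qed.

Lemma normc_expi x : normc (expi x) = 1.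
Proof. by rewrite /= cos2Dsin2 sqrtr1. Qed.

Lemma expiNK x : expi (- x) * expi x = 1.
Proof. by rewrite -expiD addNr expi0. Qed.

End complex_numbers.

(** * Measurability of complex-valued functions *)

Section complex_measurable.
Context d (T : measurableType d) {R : realType}.
Implicit Types (f g : T -> R[i]) (z : R[i]).
Local Notation normc := Normc.normc.

(** The domain is an arbitrary measurable type because Fubini's theorem needs this notion on [R * R]
    as well as on [R]. *)
Definition cmeasurable f :=
  measurable_fun setT (fun x => complex.Re (f x)) /\
  measurable_fun setT (fun x => complex.Im (f x)).

Lemma cmeasurable_cst z : cmeasurable (cst z).
Proof. by split; exact: measurable_cst. Qed.

Lemma cmeasurableD f g : cmeasurable f -> cmeasurable g ->
  cmeasurable (fun x => f x + g x).
Proof.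
move=> [rf jf] [rg jg]; split.
  by under eq_fun do rewrite Re_addc; exact: measurable_funD.
by under eq_fun do rewrite Im_addc; exact: measurable_funD.
Qed.

Lemma cmeasurableM f g : cmeasurable f -> cmeasurable g ->
  cmeasurable (fun x => f x * g x).
Proof.
move=> [rf jf] [rg jg]; split.
  by under eq_fun do rewrite Re_mulc; apply: measurable_funB; exact: measurable_funM.
by under eq_fun do rewrite Im_mulc; apply: measurable_funD; exact: measurable_funM.
Qed.

Lemma cmeasurableJ f : cmeasurable f -> cmeasurable (fun x => conjc (f x)).
Proof.
move=> [rf jf]; split; first by under eq_fun do rewrite Re_conjc.
by under eq_fun do rewrite Im_conjc; exact: measurableT_comp.
Qed.

Lemma cmeasurable_real (r : T -> R) : measurable_fun setT r ->
  cmeasurable (fun x => (r x)%:C).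
Proof. by move=> mr; split => //; exact: measurable_cst. Qed.

Lemma cmeasurable_expi (r : T -> R) : measurable_fun setT r ->
  cmeasurable (fun x => expi (r x)).
Proof.
move=> mr; split; apply: measurableT_comp mr; apply: continuous_measurable_fun.
  exact: continuous_cos.
exact: continuous_sin.
Qed.

Lemma measurable_normc f : cmeasurable f ->
  measurable_fun setT (fun x => normc (f x)).
Proof.
move=> [rf jf].
rewrite (_ : (fun _ => _) =
    fun x => Num.sqrt (complex.Re (f x) ^+ 2 + complex.Im (f x) ^+ 2)).
  apply: measurableT_comp.
    by apply: continuous_measurable_fun; exact: sqrt_continuous.
  by apply: measurable_funD; exact: measurable_funX.
by apply/funext => x; case: (f x).
Qed.

End complex_measurable.

Lemma cmeasurable_comp d d' (S : measurableType d) (T : measurableType d')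
    (R : realType) (f : T -> R[i]) (p : S -> T) :
  cmeasurable f -> measurable_fun setT p -> cmeasurable (fun x => f (p x)).
Proof.
move=> [rf jf] mp; split.
  exact: (measurableT_comp rf mp).
exact: (measurableT_comp jf mp).
Qed.

(** * Integrals of complex-valued functions *)

Section complex_integral.
Context {R : realType}.
Let mu := @lebesgue_measure R.
Implicit Types (f g h : R -> R[i]) (z : R[i]).
Local Notation normc := Normc.normc.

Definition rintegrable (r : R -> R) := mu.-integrable setT (EFin \o r).

Lemma rintegrableD (r t : R -> R) : rintegrable r -> rintegrable t ->
  rintegrable (fun x => r x + t x).
Proof. by move=> ir it; exact: (integrableD measurableT ir it). Qed.

Lemma rintegrableZl (k : R) (r : R -> R) : rintegrable r ->
  rintegrable (fun x => k * r x).
Proof. by move=> ir; exact: (integrableZl measurableT k ir). Qed.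

Lemma rintegrable_measurable (r : R -> R) : rintegrable r -> measurable_fun setT r.
Proof. by move=> ir; apply/measurable_EFinP; exact: (measurable_int mu ir). Qed.

Lemma le_rintegrable (r t : R -> R) : measurable_fun setT r -> rintegrable t ->
  (forall x, `|r x| <= t x) -> rintegrable r.
Proof.
move=> mr it rt; apply: (le_integrable measurableT _ _ it).
  exact/measurable_EFinP.
by move=> x _; rewrite /= lee_fin (le_trans (rt x))// ler_norm.
Qed.

Lemma EFin_Rintegral (r : R -> R) : rintegrable r ->
  (\int[mu]_x r x)%:E = (\int[mu]_x (r x)%:E)%E.
Proof. by move=> ir; rewrite fineK//; exact: (integrable_fin_num measurableT ir). Qed.

Definition cintegrable f := rintegrable (re f) /\ rintegrable (im f).

Lemma cintegrableP f : cintegrable f <->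
  cmeasurable f /\ rintegrable (fun x => normc (f x)).
Proof.
split=> [[rf jf]|[mf fi]].
  have mf : cmeasurable f by split; exact: rintegrable_measurable.
  split=> //; apply: (le_rintegrable (measurable_normc mf)
    (rintegrableD (integrable_norm rf) (integrable_norm jf))).
  by move=> x; rewrite ger0_norm ?normc_ge0//; exact: ler_normc_ReIm.
have [mr mj] := mf.
split; apply: (le_rintegrable _ fi) => // x.
  exact: ler_Re_normc.
exact: ler_Im_normc.
Qed.

Lemma cintegrable_measurable f : cintegrable f -> cmeasurable f.
Proof. by move=> /cintegrableP[]. Qed.

Lemma cintegrable_normc f : cintegrable f -> rintegrable (fun x => normc (f x)).
Proof. by move=> /cintegrableP[]. Qed.

Lemma le_cintegrable f (r : R -> R) : cmeasurable f -> rintegrable r ->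
  (forall x, normc (f x) <= r x) -> cintegrable f.
Proof.
move=> mf ir fr; apply/cintegrableP; split=> //.
apply: (le_rintegrable (measurable_normc mf) ir) => x.
by rewrite ger0_norm ?normc_ge0.
Qed.

Lemma cintegrableD f g : cintegrable f -> cintegrable g ->
  cintegrable (fun x => f x + g x).
Proof.
move=> fi gi; apply: (@le_cintegrable _ (fun x => normc (f x) + normc (g x))).
- by apply: cmeasurableD; exact: cintegrable_measurable.
- by apply: rintegrableD; exact: cintegrable_normc.
- by move=> x; exact: le_normcD.
Qed.

Lemma cintegrable_bounded (k : R) f g : cmeasurable g ->
  (forall x, normc (g x) <= k) -> cintegrable f -> cintegrable (fun x => g x * f x).
Proof.
move=> mg gk fi; apply: (@le_cintegrable _ (fun x => k * normc (f x))).
- by apply: cmeasurableM => //; exact: cintegrable_measurable.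
- by apply: rintegrableZl; exact: cintegrable_normc.
- by move=> x; rewrite Normc.normcM ler_wpM2r// normc_ge0.
Qed.

Lemma cintegrableZl z f : cintegrable f -> cintegrable (fun x => z * f x).
Proof.
apply: (@cintegrable_bounded (normc z)) => //; exact: cmeasurable_cst.
Qed.

Lemma cintegrableB f g : cintegrable f -> cintegrable g ->
  cintegrable (fun x => f x - g x).
Proof.
move=> fi gi; have := cintegrableD fi (cintegrableZl (-1) gi).
by under eq_fun do rewrite mulN1r.
Qed.

Lemma cintegrableJ f : cintegrable f -> cintegrable (fun x => conjc (f x)).
Proof.
move=> fi; apply: (@le_cintegrable _ (fun x => normc (f x))).
- by apply: cmeasurableJ; exact: cintegrable_measurable.
- exact: cintegrable_normc.
- by move=> x; rewrite normcJ_real.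
Qed.

Lemma cintegrable_real (r : R -> R) : rintegrable r ->
  cintegrable (fun x => (r x)%:C).
Proof. by move=> ir; split => //; exact: integrable0. Qed.

Lemma eq_Cintegral f g : f =1 g -> Cintegral f = Cintegral g.
Proof. by move=> /funext ->. Qed.

Lemma Re_Cintegral f : complex.Re (Cintegral f) = \int[mu]_x re f x.
Proof. by []. Qed.

Lemma Im_Cintegral f : complex.Im (Cintegral f) = \int[mu]_x im f x.
Proof. by []. Qed.

Lemma CintegralD f g : cintegrable f -> cintegrable g ->
  Cintegral (fun x => f x + g x) = Cintegral f + Cintegral g.
Proof.
move=> [rf jf] [rg jg]; apply: complex_ext; rewrite ?Re_addc ?Im_addc !(Re_Cintegral, Im_Cintegral).
  rewrite -RintegralD//; apply: eq_Rintegral => x _; exact: Re_addc.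
rewrite -RintegralD//; apply: eq_Rintegral => x _; exact: Im_addc.
Qed.

Lemma CintegralZl z f : cintegrable f ->
  Cintegral (fun x => z * f x) = z * Cintegral f.
Proof.
move=> [rf jf].
apply: complex_ext; rewrite ?Re_mulc ?Im_mulc !(Re_Cintegral, Im_Cintegral).
  rewrite -!RintegralZl// -RintegralB//; [|exact: rintegrableZl..].
  apply: eq_Rintegral => x _; exact: Re_mulc.
rewrite -!RintegralZl// -RintegralD//; [|exact: rintegrableZl..].
apply: eq_Rintegral => x _; exact: Im_mulc.
Qed.

Lemma CintegralB f g : cintegrable f -> cintegrable g ->
  Cintegral (fun x => f x - g x) = Cintegral f - Cintegral g.
Proof.
move=> fi gi; rewrite -[in RHS]mulN1r -CintegralZl// -CintegralD//.
  by apply: eq_Cintegral => x; rewrite mulN1r.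
exact: cintegrableZl.
Qed.

Lemma CintegralJ f : cintegrable f ->
  Cintegral (fun x => conjc (f x)) = conjc (Cintegral f).
Proof.
move=> [rf jf]; apply: complex_ext; rewrite ?Re_conjc ?Im_conjc !(Re_Cintegral, Im_Cintegral).
  by apply: eq_Rintegral => x _; exact: Re_conjc.
rewrite -mulN1r -RintegralZl//; apply: eq_Rintegral => x _.
by rewrite mulN1r; exact: Im_conjc.
Qed.

Lemma Cintegral_real (r : R -> R) :
  Cintegral (fun x => (r x)%:C) = (\int[mu]_x r x)%:C.
Proof. by apply: complex_ext => //; rewrite Im_Cintegral /im/= Rintegral_cst// mul0r. Qed.

(* The factor 2 makes this immediate from the two real integrals, and only
   convergence to zero is ever deduced from it. *)
Lemma normc_Cintegral f : cintegrable f ->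
  normc (Cintegral f) <= 2 * \int[mu]_x normc (f x).
Proof.
move=> fi; have [rf jf] := fi; have nf := cintegrable_normc fi.
apply: (le_trans (ler_normc_ReIm _)).
rewrite mulr_natl mulr2n; apply: lerD.
  apply: (le_trans (le_normr_Rintegral measurableT rf)).
  apply: le_Rintegral => //; first exact: integrable_norm.
  by move=> x _; exact: ler_Re_normc.
apply: (le_trans (le_normr_Rintegral measurableT jf)).
apply: le_Rintegral => //; first exact: integrable_norm.
by move=> x _; exact: ler_Im_normc.
Qed.

Lemma normc_Cintegral_le f (r : R -> R) : cintegrable f ->
  rintegrable r -> (forall x, normc (f x) <= r x) ->
  normc (Cintegral f) <= 2 * \int[mu]_x r x.
Proof.
move=> fi ir fr; apply: (le_trans (normc_Cintegral fi)).
rewrite ler_wpM2l//; apply: le_Rintegral => //.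
exact: cintegrable_normc.
Qed.

End complex_integral.

(** * Fubini and the Fourier multiplication formula *)

Section fubini.
Context {R : realType}.
Let mu := @lebesgue_measure R.
Local Notation normc := Normc.normc.

Section real_fubini.
Variables (k : R -> R -> R) (a b : R -> R).
Hypotheses (mk : measurable_fun setT (fun z : R * R => k z.1 z.2))
  (ia : rintegrable a) (ib : rintegrable b)
  (kab : forall x v, `|k x v| <= a x * b v).

Lemma rintegrable_fubini_slice x : rintegrable (k x).
Proof.
apply: (le_rintegrable _ (rintegrableZl (a x) ib)) => // .
exact: (measurableT_comp mk (pair1_measurable x)).
Qed.

(** Domination by [a x * b v] bounds the iterated integral of [|k|] by the product of the L^1 norms
    of [a] and [b], and a finite iterated integral of the modulus is joint integrability. *)
Lemma integrable_fubini_prod :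
  (mu \x mu)%E.-integrable setT (fun z : R * R => (k z.1 z.2)%:E).
Proof.
apply/integrable12ltyP; first exact/measurable_EFinP.
apply: (@le_lt_trans _ _ (\int[mu]_x ((\int[mu]_v `|b v|) * `|a x|)%:E)%E); last first.
  have := rintegrableZl (\int[mu]_v `|b v|) (integrable_norm ia).
  by move=> /(integrable_lty measurableT).
apply: ge0_le_integral => //.
- by move=> x _; exact: integral_ge0.
- apply: (@measurable_fun_fubini_tonelli_F _ _ _ _ _ mu
    (fun z : R * R => `|(k z.1 z.2)%:E|%E)) => //.
  by apply: measurableT_comp => //; exact/measurable_EFinP.
- apply/measurable_EFinP/measurable_funM => //.
  by apply: measurableT_comp => //; exact: rintegrable_measurable.
move=> x _; rewrite mulrC -RintegralZl//; last exact: integrable_norm.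
have iab : rintegrable (fun v => `|a x| * `|b v|).
  by apply: rintegrableZl; exact: integrable_norm.
rewrite [leRHS]fineK; last exact: (integrable_fin_num measurableT iab).
apply: ge0_le_integral => //.
- apply: measurableT_comp => //; apply/measurable_EFinP.
  exact: (measurableT_comp mk (pair1_measurable x)).
- by apply/measurable_EFinP; exact: rintegrable_measurable.
- by move=> v _; rewrite lee_fin -normrM (le_trans (kab x v))// ler_norm.
Qed.

End real_fubini.

Lemma Rintegral_fubini (k : R -> R -> R) (a b : R -> R) :
  measurable_fun setT (fun z : R * R => k z.1 z.2) ->
  rintegrable a -> rintegrable b -> (forall x v, `|k x v| <= a x * b v) ->
  \int[mu]_x (\int[mu]_v k x v) = \int[mu]_v (\int[mu]_x k x v).
Proof.
move=> mk ia ib kab.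
have mk' : measurable_fun setT (fun z : R * R => k z.2 z.1).
  exact: (measurableT_comp mk (@measurable_swap _ _ _ _)).
have kba v x : `|k x v| <= b v * a x by rewrite mulrC.
have i12 := rintegrable_fubini_slice mk ib kab.
have i21 := rintegrable_fubini_slice mk' ia kba.
have := Fubini (integrable_fubini_prod mk ia ib kab).
rewrite /Rintegral => E; congr fine.
under eq_integral do rewrite (fineK (integrable_fin_num measurableT (i12 _))).
under [RHS]eq_integral do rewrite (fineK (integrable_fin_num measurableT (i21 _))).
exact: E.
Qed.

Lemma Cintegral_fubini (k : R -> R -> R[i]) (a b : R -> R) :
  cmeasurable (fun z : R * R => k z.1 z.2) ->
  rintegrable a -> rintegrable b -> (forall x v, normc (k x v) <= a x * b v) ->
  Cintegral (fun x => Cintegral (k x)) =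
  Cintegral (fun v => Cintegral (fun x => k x v)).
Proof.
move=> [rk jk] ia ib kab; apply: complex_ext.
  apply: (Rintegral_fubini rk ia ib) => x v.
  by apply: le_trans (kab x v); exact: ler_Re_normc.
apply: (Rintegral_fubini jk ia ib) => x v.
by apply: le_trans (kab x v); exact: ler_Im_normc.
Qed.

End fubini.

(** * The Fourier transform of an integrable function *)

Section fourier.
Context {R : realType}.
Let mu := @lebesgue_measure R.
Local Notation normc := Normc.normc.
Implicit Types (f g h phi : R -> R[i]).

(** The scale [s] is a parameter so that the same definition serves the forward transform ([s]) and
    the inverse one ([- s]). There is no normalisation, whence the constant [2 * pi / |s|] in the
    inversion formula and in Plancherel's identity. *)
Definition ft (s : R) h : R -> R[i] :=
  fun v => Cintegral (fun x => expi (s * x * v) * h x).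

Lemma cintegrable_ft s h v : cintegrable h ->
  cintegrable (fun x => expi (s * x * v) * h x).
Proof.
apply: (@cintegrable_bounded _ 1); last by move=> x; rewrite normc_expi.
by apply: cmeasurable_expi; apply: measurable_funM => //; exact: measurable_funM.
Qed.

Lemma normc_ft s h v : cintegrable h -> normc (ft s h v) <= 2 * \int[mu]_x normc (h x).
Proof.
move=> hi; apply: normc_Cintegral_le; first exact: cintegrable_ft.
  exact: cintegrable_normc.
by move=> x; rewrite Normc.normcM normc_expi mul1r.
Qed.

Lemma ftJ s h v : cintegrable h -> conjc (ft s h v) = ft (- s) (fun x => conjc (h x)) v.
Proof.
move=> hi; rewrite -CintegralJ; last exact: cintegrable_ft.
by apply: eq_Cintegral => x; rewrite conjcM conjc_expi !mulNr.
Qed.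

(** Continuity under the integral sign with majorant [|h|]; the interval of radius 1 about [v0] is
    an arbitrary neighbourhood. *)
Lemma continuous_re_ft s h : cintegrable h -> continuous (re (ft s h)).
Proof.
move=> hi v0.
pose f v x := complex.Re (expi (s * x * v) * h x).
have h1 (x : R) : `]v0 - 1, v0 + 1[%classic x -> mu.-integrable setT (EFin \o f x).
  by move=> _; have [] := cintegrable_ft s x hi.
have h2 : {ae mu, forall y, setT y -> {in `]v0 - 1, v0 + 1[%classic, continuous (f^~ y)}}.
  apply: aeW => y _ v _.
  have -> : f^~ y = fun v => cos (s * y * v) * complex.Re (h y) -
      sin (s * y * v) * complex.Im (h y).
    by apply/funext => w; rewrite /f Re_mulc.
  by apply: cvgB; apply: cvgM; (try exact: cvg_cst);
    [apply: continuous_comp; [exact: mulrl_continuous|exact: continuous_cos]|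
     apply: continuous_comp; [exact: mulrl_continuous|exact: continuous_sin]].
have h3 (x : R) : `]v0 - 1, v0 + 1[%classic x ->
    {ae mu, forall y, setT y -> `|f x y| <= normc (h y)}.
  move=> _; apply: aeW => y _; apply: (le_trans (ler_Re_normc _)).
  by rewrite Normc.normcM normc_expi mul1r.
apply: (continuity_under_integral measurableT h1 h2 (cintegrable_normc hi) h3).
by rewrite inE /= in_itv/= ltrDl gtrDl ltrN10 ltr01.
Qed.

(** Since [Im z = Re (- i z)], regularity of the imaginary part follows from that of the real part,
    applied to [- i h]. *)
Lemma im_ft s h : im (ft s h) = re (ft s (fun x => - 'i * h x)).
Proof.
apply/funext => v; apply: eq_Rintegral => x _; rewrite /re /im.
case: (h x) => p q; rewrite /=; ring.
Qed.

Lemma continuous_im_ft s h : cintegrable h -> continuous (im (ft s h)).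
Proof. by move=> hi; rewrite im_ft; apply: continuous_re_ft; exact: cintegrableZl. Qed.

Lemma cmeasurable_ft s h : cintegrable h -> cmeasurable (ft s h).
Proof.
move=> hi; split; apply: continuous_measurable_fun.
  exact: continuous_re_ft.
exact: continuous_im_ft.
Qed.

Lemma cintegrable_mul_ft s h phi : cintegrable h -> cintegrable phi ->
  cintegrable (fun v => ft s h v * phi v).
Proof.
move=> hi; apply: cintegrable_bounded; first exact: cmeasurable_ft.
by move=> v; exact: normc_ft.
Qed.

(** The kernel [expi (s * x * v)] is symmetric in [x] and [v], so this is Fubini with the product
    majorant [|phi v| |h x|]. *)
Lemma ft_multiplication s h phi : cintegrable h -> cintegrable phi ->
  Cintegral (fun v => ft s h v * phi v) = Cintegral (fun x => h x * ft s phi x).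
Proof.
move=> hi pi.
rewrite (@eq_Cintegral _ _ (fun v => Cintegral (fun x => expi (s * x * v) * (h x * phi v)))).
  rewrite (@Cintegral_fubini _ _ (fun v => normc (phi v)) (fun x => normc (h x))).
  - apply: eq_Cintegral => x; rewrite /ft -CintegralZl; last exact: cintegrable_ft.
    by apply: eq_Cintegral => v; rewrite mulrCA (mulrAC s).
  - apply: cmeasurableM; last apply: cmeasurableM.
    + apply: cmeasurable_expi; apply: measurable_funM => //.
      by apply: measurable_funM => //; exact: measurable_snd.
    + exact: (cmeasurable_comp (cintegrable_measurable hi) measurable_snd).
    + exact: (cmeasurable_comp (cintegrable_measurable pi) measurable_fst).
  - exact: cintegrable_normc.
  - exact: cintegrable_normc.
  - by move=> v x; rewrite !Normc.normcM normc_expi mul1r mulrC.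
move=> v; rewrite /ft mulrC -CintegralZl; last exact: cintegrable_ft.
by apply: eq_Cintegral => x; rewrite [LHS]mulrC; exact/esym/mulrA.
Qed.

End fourier.

(** * The Poisson kernel *)

Section poisson_kernel.
Context {R : realType}.
Let mu := @lebesgue_measure R.
Local Notation normc := Normc.normc.

Lemma integral_oneDsqrV : (\int[mu]_x (1 + x ^+ 2)^-1%:E = pi%:E)%E.
Proof.
rewrite ge0_symfun_integralT.
- rewrite -set_itvcy; have := @integral0y_oneDsqr R.
  rewrite /oneDsqr => ->; rewrite -EFinM; congr EFin; by field.
- by move=> x; rewrite invr_ge0; apply: addr_ge0 => //; exact: sqr_ge0.
- exact: (@continuous_oneDsqrV R).
- by move=> x; rewrite /= sqrrN.
Qed.

(** The Fourier transform of [exp (- e |v|)] at frequency [s t]: an unnormalised Poisson kernel of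
    the half-plane, with total mass [2 pi / |s|] for every [e]. *)
Definition poisson (s e t : R) : R := 2 * e / (e ^+ 2 + (s * t) ^+ 2).

Implicit Types (e t x y : R).
Variable s : R.
Hypothesis s0 : s != 0.

Lemma poisson_ge0 e t : 0 < e -> 0 <= poisson s e t.
Proof.
by move=> e0; rewrite divr_ge0 ?mulr_ge0 ?addr_ge0 ?sqr_ge0 ?(ltW e0).
Qed.

Lemma poisson_denom_gt0 e t : 0 < e -> 0 < e ^+ 2 + (s * t) ^+ 2.
Proof. by move=> e0; rewrite ltr_wpDr ?sqr_ge0// exprn_gt0. Qed.

Lemma continuous_poisson e x : 0 < e -> continuous (fun t => poisson s e (t - x)).
Proof.
move=> e0 t; apply: cvgM; first exact: cvg_cst.
apply: cvgV; first by rewrite gt_eqF// poisson_denom_gt0.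
apply: cvgD; first exact: cvg_cst.
apply: (@continuous_comp _ _ _ (fun t => s * (t - x)) (fun y => y ^+ 2)).
  by apply: cvgM; [exact: cvg_cst|apply: cvgB; [exact: cvg_id|exact: cvg_cst]].
exact: exprn_continuous.
Qed.

Lemma integral_poisson e x : 0 < e ->
  (\int[mu]_t (poisson s e (t - x))%:E = (2 * pi / `|s|)%:E)%E.
Proof.
(* With [t = x + k y] one has [(s (t - x))^2 = e^2 y^2], and the integrand becomes [2 / |s|] times
   [(1 + y^2)^-1]. *)
move=> e0; pose k : R := e / `|s|.
have k0 : 0 < k by rewrite divr_gt0// normr_gt0.
pose F (y : R) : R := x + k * y.
have dF (y : R) : is_derive y 1 F k.
  by rewrite /F; apply: is_derive_eq; rewrite add0r mul1r /GRing.scale/= mulr1.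
have dFE : derive1 F = cst k.
  by apply/funext => y; rewrite derive1E; exact: derive_val.
rewrite (@increasing_ge0_integration_by_substitutionT _ F); last first.
  by move=> t; exact: poisson_ge0.
- exact: continuous_poisson.
- apply/cvgryPge => A; near=> y; rewrite /F -lerBlDl -(ler_pdivrMl _ _ k0).
  by near: y; apply: nbhs_pinfty_ge; exact: num_real.
- apply/cvgrNyPle => A; near=> y; rewrite /F -lerBrDl -(ler_pdivlMl _ _ k0).
  by near: y; apply: nbhs_ninfty_le; exact: num_real.
- by move=> y; exact: ex_derive.
- by rewrite dFE; exact: is_cvg_cst.
- by rewrite dFE; exact: is_cvg_cst.
- by rewrite dFE => y; exact: cst_continuous.
- by move=> y z yz; rewrite /F ltrD2l ltr_pM2l.
rewrite dFE.
under eq_integral => y _.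
  have -> : ((((fun t => poisson s e (t - x)) \o F) * cst k) y) = 2 / `|s| * (1 + y ^+ 2)^-1.
    rewrite /F /poisson /k /= fctE /=.
    have -> : s * (x + e / `|s| * y - x) = e * y * (s / `|s|).
      by field; rewrite normr_eq0.
    rewrite exprMn expr_div_n real_normK ?num_real// divff ?sqrf_eq0// mulr1.
    have y1 : 1 + y ^+ 2 != 0 by rewrite gt_eqF// ltr_pwDl// sqr_ge0.
    rewrite exprMn -[X in X + _]mulr1 -mulrDr.
    by field; rewrite y1 (gt_eqF e0) normr_eq0 s0.
  over.
rewrite /=; under eq_integral do rewrite EFinM.
rewrite ge0_integralZl_EFin//.
- by rewrite integral_oneDsqrV -EFinM mulrAC.
- by move=> y _; rewrite lee_fin invr_ge0; apply: addr_ge0 => //; exact: sqr_ge0.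
- apply/measurable_EFinP; apply: continuous_measurable_fun; exact: (@continuous_oneDsqrV R).
Unshelve. all: by end_near. Qed.

End poisson_kernel.

(** * The two-sided exponential and its Fourier transform *)

Section exp_abs.
Context {R : realType}.
Let mu := @lebesgue_measure R.
Implicit Types (e t x y v : R).

Definition exp_abs e v : R := expR (- e * `|v|).

Lemma exp_abs_ge0 e v : 0 <= exp_abs e v.
Proof. exact: expR_ge0. Qed.

Lemma continuous_exp_abs e : continuous (exp_abs e).
Proof.
move=> v; apply: (@continuous_comp _ _ _ (fun v => - e * `|v|) expR).
  by apply: cvgM; [exact: cvg_cst|exact: norm_continuous].
exact: continuous_expR.
Qed.

(** Adding 1 to the cosine makes the integrand nonnegative, so the improper integral can be
    evaluated by an antiderivative before any integrability is known. The case [t = 0] then gives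
    the integral of [exp_abs] alone, which can be subtracted. *)
Lemma integral_cos1_exp_abs e t : 0 < e ->
  (\int[mu]_v ((1 + cos (t * v)) * exp_abs e v)%:E =
   (2 / e + 2 * e / (e ^+ 2 + t ^+ 2))%:E)%E.
Proof.
move=> e0; have et : 0 < e ^+ 2 + t ^+ 2 by rewrite ltr_wpDr ?sqr_ge0// exprn_gt0.
have cf : continuous (fun v => (1 + cos (t * v)) * exp_abs e v).
  move=> v; apply: cvgM; last exact: continuous_exp_abs.
  apply: cvgD; first exact: cvg_cst.
  by apply: continuous_comp; [exact: mulrl_continuous|exact: continuous_cos].
have f0 v : 0 <= (1 + cos (t * v)) * exp_abs e v.
  by rewrite mulr_ge0 ?exp_abs_ge0// -lerBlDl sub0r cos_geN1.
rewrite ge0_symfun_integralT//; last first.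
  by move=> v; rewrite /= /exp_abs normrN mulrN cosN.
(* The antiderivative on the half-line that vanishes at infinity. *)
pose F v := expR (- e * v) *
  ((t * sin (t * v) - e * cos (t * v)) / (e ^+ 2 + t ^+ 2) - e^-1).
have dF v : is_derive v 1 F ((1 + cos (t * v)) * expR (- e * v)).
  rewrite /F; apply: is_derive_eq; rewrite /GRing.scale/=.
  by field; rewrite !gt_eqF.
rewrite -set_itvcy (@ge0_continuous_FTC2y _ _ F _ 0).
- rewrite -EFinB -EFinM /F !mulr0 expR0 sin0 cos0; congr EFin.
  by field; rewrite !gt_eqF.
- by move=> v _; exact: f0.
- exact: continuous_subspaceT.
- pose k := (`|t| + e) / (e ^+ 2 + t ^+ 2) + e^-1.
  have k0 : 0 <= k.
    apply: addr_ge0; last by rewrite invr_ge0 ltW.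
    by apply: divr_ge0; [apply: addr_ge0 => //; exact: ltW|exact: ltW].
  apply/cvgr0Pnorm_le => r r0; near=> v.
  rewrite /F normrM ger0_norm ?expR_ge0//.
  apply: (@le_trans _ _ (expR (- e * v) * k)).
    rewrite ler_wpM2l ?expR_ge0//; apply: (le_trans (ler_normB _ _)); apply: lerD.
      rewrite normrM normfV (gtr0_norm et) ler_pM2r ?invr_gt0//.
      apply: (le_trans (ler_normB _ _)); apply: lerD; rewrite normrM.
        by rewrite -[leRHS]mulr1 ler_wpM2l// ler_norml sin_geN1 sin_le1.
      by rewrite (gtr0_norm e0) -[leRHS]mulr1 ler_wpM2l ?(ltW e0)// ler_norml cos_geN1 cos_le1.
    by rewrite normfV gtr0_norm.
  have v0 : 0 < v by near: v; apply: nbhs_pinfty_gt; exact: num_real.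
  (* The bound [exp (e v) >= 1 + e v] is enough to make [exp (- e v) * k] at most [r] once
     [v >= k / r / e]. *)
  rewrite mulNr expRN.
  have : 1 + e * v <= expR (e * v) by exact: expR_ge1Dx.
  have : k / r / e <= v by near: v; apply: nbhs_pinfty_ge; exact: num_real.
  rewrite ler_pdivrMr// ler_pdivrMr// => kv ev.
  rewrite mulrC ler_pdivrMr ?expR_gt0// (le_trans kv)// mulrC ler_pM2l//.
  by rewrite mulrC (le_trans _ ev)// lerDr.
- by move=> v _; exact: ex_derive.
- apply: cvg_at_right_filter; apply: differentiable_continuous.
  by apply/derivable1_diffP; exact: ex_derive.
- move=> v; rewrite in_itv/= andbT => v0.
  by rewrite derive1E derive_val /exp_abs gtr0_norm.
Unshelve. all: by end_near. Qed.

Lemma integral_exp_abs e : 0 < e -> (\int[mu]_v (exp_abs e v)%:E = (2 / e)%:E)%E.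
Proof.
move=> e0; have := integral_cos1_exp_abs 0 e0.
under eq_integral do rewrite mul0r cos0 EFinM.
rewrite ge0_integralZl_EFin//; last 2 first.
- by move=> v _; rewrite lee_fin exp_abs_ge0.
- by apply/measurable_EFinP; apply: continuous_measurable_fun; exact: continuous_exp_abs.
move=> /(congr1 (fun z => 2^-1%:E * z)%E).
rewrite muleA -EFinM -(natrD _ 1 1) mulVf// mul1e => ->.
by rewrite -EFinM; congr EFin; field; rewrite gt_eqF.
Qed.

Lemma rintegrable_exp_abs e : 0 < e -> rintegrable (exp_abs e).
Proof.
move=> e0; apply/integrableP; split.
  by apply/measurable_EFinP; apply: continuous_measurable_fun; exact: continuous_exp_abs.
under eq_integral do rewrite /= ger0_norm ?exp_abs_ge0//.
by rewrite integral_exp_abs// ltry.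
Qed.

(** Negation preserves Lebesgue measure, so the integral equals its own opposite. *)
Lemma Rintegral_odd (f : R -> R) : rintegrable f -> (forall x, f (- x) = - f x) ->
  \int[mu]_x f x = 0.
Proof.
move=> fi fN; have mf := rintegrable_measurable fi.
have mN : measurable_fun setT (-%R : R -> measurableTypeR R) by [].
suff : \int[mu]_x f x = - \int[mu]_x f x by lra.
rewrite -mulN1r -RintegralZl// /Rintegral; congr fine.
rewrite [LHS](_ : _ = \int[pushforward mu (-%R : R -> measurableTypeR R)]_x (f x)%:E)%E.
  rewrite integral_pushforward//.
  - by apply: eq_integral => x _; rewrite /= fN mulN1r.
  - exact/measurable_EFinP.
  - rewrite preimage_setT (_ : _ \o _ = EFin \o (fun x => -1 * f x)).
      exact: rintegrableZl.
    by apply/funext => x; rewrite /= fN mulN1r.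
by apply: eq_measure_integral => A mA _; exact/esym/lebesgue_measureN.
Qed.

Lemma ft_exp_abs e t : 0 < e ->
  Cintegral (fun v => expi (t * v) * (exp_abs e v)%:C) = (2 * e / (e ^+ 2 + t ^+ 2))%:C.
Proof.
move=> e0.
have ib (f : R -> R) : continuous f -> (forall v, `|f v| <= 1) ->
    rintegrable (fun v => f v * exp_abs e v).
  move=> cf f1; apply: le_rintegrable (rintegrable_exp_abs e0) _.
    apply: measurable_funM; first exact: continuous_measurable_fun.
    by apply: continuous_measurable_fun; exact: continuous_exp_abs.
  by move=> v; rewrite normrM (ger0_norm (exp_abs_ge0 _ _)) ler_piMl// exp_abs_ge0.
have ic : rintegrable (fun v => cos (t * v) * exp_abs e v).
  apply: ib => v; last by rewrite ler_norml cos_geN1 cos_le1.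
  by apply: continuous_comp; [exact: mulrl_continuous|exact: continuous_cos].
have isn : rintegrable (fun v => sin (t * v) * exp_abs e v).
  apply: ib => v; last by rewrite ler_norml sin_geN1 sin_le1.
  by apply: continuous_comp; [exact: mulrl_continuous|exact: continuous_sin].
apply: complex_ext; rewrite /Cintegral /re /im /=.
  under eq_Rintegral do rewrite mulr0 subr0.
  have := congr1 fine (integral_cos1_exp_abs t e0).
  rewrite -/(Rintegral _ _ _) /=; under eq_Rintegral do rewrite mulrDl mul1r.
  rewrite RintegralD//; last exact: rintegrable_exp_abs.
  by rewrite [X in X + _](_ : _ = 2 / e) => [/addrI//|]; rewrite /Rintegral integral_exp_abs.
under eq_Rintegral do rewrite mulr0 add0r.
apply: Rintegral_odd => // v.
by rewrite /exp_abs normrN mulrN sinN mulNr.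
Qed.

End exp_abs.

(** * Square-integrable functions *)

Section square_integrable.
Context {R : realType}.
Let mu := @lebesgue_measure R.
Local Notation normc := Normc.normc.
Implicit Types (f g h phi : R -> R[i]).

(** A real-valued L^2 norm, convenient for algebra; it agrees with [LnormC 2] for functions in L^2,
    by [LnormC_norm2]. *)
Definition norm2 f : R := Num.sqrt (\int[mu]_x normc (f x) ^+ 2).

Lemma LnormC2E f :
  LnormC 2 f = ((\int[mu]_x (normc (f x) ^+ 2)%:E) `^ 2^-1)%E.
Proof.
rewrite /LnormC unlock; congr (_ `^ _)%E; apply: eq_integral => x _ /=.
by rewrite ger0_norm ?normc_ge0// powR_mulrn// normc_ge0.
Qed.

Lemma inL2P f : inL 2 f <-> cmeasurable f /\ rintegrable (fun x => normc (f x) ^+ 2).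
Proof.
have E : (LnormC 2 f < +oo)%E = (\int[mu]_x (normc (f x) ^+ 2)%:E < +oo)%E.
  have P (y : \bar R) : (0 <= y)%E -> (y `^ 2^-1 < +oo)%E = (y < +oo)%E.
    by case: y => [r _|_|//]; rewrite poweRE invr_eq0 pnatr_eq0/= ?ltry ?ltxx.
  by rewrite LnormC2E P//; apply: integral_ge0 => x _; rewrite lee_fin sqr_ge0.
split=> [[rf jf fy]|[[rf jf] fi]].
  split=> //; apply/integrableP; split.
    by apply/measurable_EFinP/measurable_funX; exact: measurable_normc.
  under eq_integral do rewrite /= ger0_norm ?sqr_ge0//.
  by rewrite -E.
split=> //; rewrite E.
by have /(integrable_lty measurableT) := fi.
Qed.

Lemma LnormC_norm2 f : inL 2 f -> LnormC 2 f = (norm2 f)%:E.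
Proof.
move=> /inL2P[_ fi]; rewrite LnormC2E /norm2 -powR12_sqrt.
  by rewrite -poweR_EFin /Rintegral fineK//; exact: (integrable_fin_num measurableT fi).
by apply: Rintegral_ge0 => x _; rewrite sqr_ge0.
Qed.

Lemma norm2_ge0 f : 0 <= norm2 f.
Proof. exact: sqrtr_ge0. Qed.

Lemma sqr_norm2 f : norm2 f ^+ 2 = \int[mu]_x normc (f x) ^+ 2.
Proof. by rewrite sqr_sqrtr//; apply: Rintegral_ge0 => x _; rewrite sqr_ge0. Qed.

Lemma inL1P f : inL 1 f <-> cintegrable f.
Proof.
have E : LnormC 1 f = (\int[mu]_x (normc (f x))%:E)%E.
  rewrite /LnormC Lnorm1; apply: eq_integral => x _.
  by rewrite /= ger0_norm ?normc_ge0.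
split=> [[rf jf fy]|fi].
  apply/cintegrableP; split=> //; apply/integrableP; split.
    by apply/measurable_EFinP; exact: measurable_normc.
  under eq_integral do rewrite /= ger0_norm ?normc_ge0//.
  by rewrite -E.
have [[rf jf] ni] := (cintegrableP f).1 fi.
by split=> //; rewrite E; exact: (integrable_lty measurableT ni).
Qed.

Lemma inL2_measurable f : inL 2 f -> cmeasurable f.
Proof. by move=> /inL2P[]. Qed.

Lemma inL2_sqr f : inL 2 f -> rintegrable (fun x => normc (f x) ^+ 2).
Proof. by move=> /inL2P[]. Qed.

Lemma le_inL2 f g : cmeasurable f -> inL 2 g ->
  (forall x, normc (f x) <= normc (g x)) -> inL 2 f.
Proof.
move=> mf /inL2P[_ gi] fg; apply/inL2P; split=> //.
apply: (le_rintegrable _ gi).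
  by apply: measurable_funX; exact: measurable_normc.
by move=> x; rewrite ger0_norm ?sqr_ge0// ler_sqr ?nnegrE ?normc_ge0.
Qed.

Lemma inL2_bounded (k : R) f g : cmeasurable g -> (forall x, normc (g x) <= k) ->
  inL 2 f -> inL 2 (fun x => g x * f x).
Proof.
move=> mg gk /inL2P[mf fi]; apply/inL2P; split; first exact: cmeasurableM.
apply: (le_rintegrable _ (rintegrableZl (k ^+ 2) fi)).
  by apply: measurable_funX; apply: measurable_normc; exact: cmeasurableM.
move=> x; rewrite ger0_norm ?sqr_ge0// Normc.normcM exprMn ler_wpM2r ?sqr_ge0//.
by rewrite ler_sqr ?nnegrE ?normc_ge0// (le_trans (normc_ge0 (g x))).
Qed.

Lemma inL2Zl (z : R[i]) f : inL 2 f -> inL 2 (fun x => z * f x).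
Proof. by apply: (@inL2_bounded (normc z)) => //; exact: cmeasurable_cst. Qed.

Lemma inL2J f : inL 2 f -> inL 2 (fun x => conjc (f x)).
Proof.
move=> fi; apply: (le_inL2 _ fi) => [|x]; last by rewrite normcJ_real.
by apply: cmeasurableJ; exact: inL2_measurable.
Qed.

Lemma inL2D f g : inL 2 f -> inL 2 g -> inL 2 (fun x => f x + g x).
Proof.
move=> /inL2P[mf fi] /inL2P[mg gi]; apply/inL2P; split; first exact: cmeasurableD.
apply: (le_rintegrable _ (rintegrableZl 2 (rintegrableD fi gi))).
  by apply: measurable_funX; apply: measurable_normc; exact: cmeasurableD.
move=> x; rewrite ger0_norm ?sqr_ge0//.
apply: (@le_trans _ _ ((normc (f x) + normc (g x)) ^+ 2)).
  by rewrite ler_sqr ?nnegrE ?addr_ge0 ?normc_ge0// le_normcD.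
rewrite -subr_ge0 (_ : _ - _ = (normc (f x) - normc (g x)) ^+ 2) ?sqr_ge0//; ring.
Qed.

Lemma inL2B f g : inL 2 f -> inL 2 g -> inL 2 (fun x => f x - g x).
Proof.
move=> fi gi; have := inL2D fi (inL2Zl (-1) gi).
by under eq_fun do rewrite mulN1r.
Qed.

Lemma eq_norm2 f g : (forall x, normc (f x) = normc (g x)) -> norm2 f = norm2 g.
Proof.
by move=> fg; congr Num.sqrt; apply: eq_Rintegral => x _; rewrite fg.
Qed.

Lemma norm2Zl (z : R[i]) f : inL 2 f -> norm2 (fun x => z * f x) = normc z * norm2 f.
Proof.
move=> fi; rewrite /norm2.
under eq_Rintegral do rewrite Normc.normcM exprMn.
rewrite RintegralZl//; last exact: inL2_sqr.
by rewrite sqrtrM ?sqr_ge0// sqrtr_sqr ger0_norm ?normc_ge0.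
Qed.

Lemma inL2M f g : inL 2 f -> inL 2 g -> cintegrable (fun x => f x * g x).
Proof.
move=> /inL2P[mf fi] /inL2P[mg gi].
apply: (le_cintegrable _ (rintegrableD fi gi)); first exact: cmeasurableM.
move=> x; rewrite Normc.normcM.
have := sqr_ge0 (normc (f x) - normc (g x)).
have := mulr_ge0 (normc_ge0 (f x)) (normc_ge0 (g x)); nra.
Qed.

Lemma cauchy_schwarz f g : inL 2 f -> inL 2 g ->
  \int[mu]_x (normc (f x) * normc (g x)) <= norm2 f * norm2 g.
Proof.
move=> fi gi; have [mf mg] := (inL2_measurable fi, inL2_measurable gi).
have ifg : rintegrable (fun x => normc (f x) * normc (g x)).
  by have := cintegrable_normc (inL2M fi gi); under eq_fun do rewrite Normc.normcM.
have := @hoelder _ _ _ mu (fun x => normc (f x)) (fun x => normc (g x)) 2 2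
   (measurable_normc mf) (measurable_normc mg) (ltr0n _ 2) (ltr0n _ 2).
rewrite -!/(LnormC 2 _) !LnormC_norm2// -EFinM Lnorm1 => H.
rewrite -lee_fin; apply: le_trans (H _); last by field.
rewrite /Rintegral fineK; last exact: (integrable_fin_num measurableT ifg).
apply: ge0_le_integral => //.
- by move=> x _; rewrite lee_fin mulr_ge0 ?normc_ge0.
- by apply/measurable_EFinP; exact: rintegrable_measurable.
- by apply/measurable_EFinP; apply: measurableT_comp => //; exact: rintegrable_measurable.
- by move=> x _; rewrite /= lee_fin ler_norm.
Qed.

Lemma normc_Cintegral_L2 f g : inL 2 f -> inL 2 g ->
  normc (Cintegral (fun x => f x * g x)) <= 2 * (norm2 f * norm2 g).
Proof.
move=> fi gi; apply: (le_trans (normc_Cintegral (inL2M fi gi))).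
rewrite ler_wpM2l//; apply: le_trans (cauchy_schwarz fi gi).
by rewrite le_eqVlt; apply/orP; left; apply/eqP/eq_Rintegral => x _; rewrite Normc.normcM.
Qed.

Lemma Cintegral_mulJ f : Cintegral (fun x => conjc (f x) * f x) = (norm2 f ^+ 2)%:C.
Proof.
by rewrite sqr_norm2 -Cintegral_real; apply: eq_Cintegral => x; rewrite mulJc.
Qed.

End square_integrable.

(** * Bessel's inequality *)

Section bessel.
Context {R : realType}.
Let mu := @lebesgue_measure R.
Local Notation normc := Normc.normc.
Implicit Types (f g h phi : R -> R[i]) (e x y v w : R).

Lemma poisson_sym (s e x y : R) : poisson s e (x - y) = poisson s e (y - x).
Proof. by rewrite /poisson -(opprB y x) mulrN sqrrN. Qed.

Lemma measurable_poisson (s e x : R) : s != 0 -> 0 < e ->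
  measurable_fun setT (fun y => poisson s e (y - x)).
Proof. by move=> s0 e0; apply: continuous_measurable_fun; exact: continuous_poisson. Qed.

Lemma poisson_le (s e t : R) : s != 0 -> 0 < e -> poisson s e t <= 2 / e.
Proof.
move=> s0 e0; have d0 := poisson_denom_gt0 s t e0.
rewrite /poisson ler_pdivrMr// -[leLHS](_ : 2 / e * e ^+ 2 = _); last by field; rewrite gt_eqF.
by rewrite ler_wpM2l ?divr_ge0 ?(ltW e0)// lerDl sqr_ge0.
Qed.

Lemma rintegrable_poisson (s e x : R) : s != 0 -> 0 < e ->
  rintegrable (fun y => poisson s e (y - x)).
Proof.
move=> s0 e0; apply/integrableP; split.
  by apply/measurable_EFinP; exact: measurable_poisson.
under eq_integral do rewrite /= ger0_norm ?poisson_ge0//.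
by rewrite integral_poisson// ltry.
Qed.

Lemma cintegrable_exp_abs e : 0 < e -> cintegrable (fun v => (exp_abs e v)%:C).
Proof. by move=> e0; apply: cintegrable_real; exact: rintegrable_exp_abs. Qed.

Lemma cintegrable_expi_exp_abs (t e : R) : 0 < e ->
  cintegrable (fun v => expi (t * v) * (exp_abs e v)%:C).
Proof.
move=> e0; apply: (@cintegrable_bounded _ 1 _ _ _ _ (cintegrable_exp_abs e0)).
  by apply: cmeasurable_expi; exact: measurable_funM.
by move=> v; rewrite normc_expi.
Qed.

Lemma ft_expi_exp_abs (s e x y : R) : 0 < e ->
  ft s (fun v => expi (- s * x * v) * (exp_abs e v)%:C) y = (poisson s e (y - x))%:C.
Proof.
move=> e0; rewrite -(ft_exp_abs (s * (y - x)) e0); apply: eq_Cintegral => v.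
by rewrite mulrA -expiD; congr (expi _ * _); ring.
Qed.

Section square_integrability.
Variables (t : R) (G : R -> R[i]).
Hypotheses (t0 : t != 0) (G1 : cintegrable G) (G2 : inL 2 G).
Let K : R := 2 * pi / `|t|.

(** Transforming back the damped conjugate transform gives the Poisson mean of [conjc G]:
    conjugation turns [ft t] into [ft (- t)], and the multiplication formula moves that transform
    onto the damped exponential. *)
Lemma ft_damped e v : 0 < e ->
  ft t (fun y => conjc (ft t G y) * (exp_abs e y)%:C) v =
  Cintegral (fun w => conjc (G w) * (poisson t e (w - v))%:C).
Proof.
move=> e0.
transitivity (Cintegral (fun y => ft (- t) (fun w => conjc (G w)) y *
    (expi (t * v * y) * (exp_abs e y)%:C))).
  apply: eq_Cintegral => y; rewrite ftJ// mulrCA; congr (_ * (expi _ * _)).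
  exact: mulrAC.
rewrite ft_multiplication; [|exact: cintegrableJ|exact: cintegrable_expi_exp_abs].
apply: eq_Cintegral => w; congr (_ * _).
have := @ft_expi_exp_abs (- t) e v w e0; rewrite opprK => ->.
by rewrite /poisson mulNr sqrrN.
Qed.

Lemma measurable_poisson2 e : 0 < e ->
  measurable_fun setT (fun z : R * R => poisson t e (z.2 - z.1)).
Proof.
move=> e0.
apply: (@measurableT_comp _ _ _ _ _ _ (poisson t e) _ (fun z : R * R => z.2 - z.1)).
  rewrite (_ : poisson t e = fun y => poisson t e (y - 0)).
    exact: measurable_poisson.
  by apply/funext => y; rewrite subr0.
by apply: measurable_funB; [exact: measurable_snd|exact: measurable_fst].
Qed.

Lemma quadratic_form_ge0 e v w : 0 < e ->
  0 <= 2 * (normc (G v) * (normc (G w) * poisson t e (w - v))).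
Proof.
move=> e0; apply: mulr_ge0 => //; apply: mulr_ge0; first exact: normc_ge0.
by apply: mulr_ge0; [exact: normc_ge0|exact: poisson_ge0].
Qed.

(* Schur's test: [2 |G v| |G w| <= |G v|^2 + |G w|^2], then Tonelli. *)
Lemma poisson_quadratic_form e : 0 < e ->
  (\int[mu]_v \int[mu]_w
     (2 * (normc (G v) * (normc (G w) * poisson t e (w - v))))%:E <=
   (2 * K)%:E * \int[mu]_v (normc (G v) ^+ 2)%:E)%E.
Proof.
move=> e0.
have mG : measurable_fun setT (fun v => normc (G v)).
  by apply: measurable_normc; exact: inL2_measurable.
have mG2 : measurable_fun setT (fun v => normc (G v) ^+ 2) by exact: measurable_funX.
have mP2 := measurable_poisson2 e0.
have P0 y : 0 <= poisson t e y by exact: poisson_ge0.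
have N0 v w := quadratic_form_ge0 v w e0.
pose A (z : R * R) : \bar R := (normc (G z.1) ^+ 2 * poisson t e (z.2 - z.1))%:E.
pose B (z : R * R) : \bar R := (normc (G z.2) ^+ 2 * poisson t e (z.2 - z.1))%:E.
have mA : measurable_fun setT A.
  apply/measurable_EFinP/measurable_funM => //.
  exact: (measurableT_comp mG2 measurable_fst).
have mB : measurable_fun setT B.
  apply/measurable_EFinP/measurable_funM => //.
  exact: (measurableT_comp mG2 measurable_snd).
have A0 z : (0 <= A z)%E by rewrite lee_fin; apply: mulr_ge0 => //; exact: sqr_ge0.
have B0 z : (0 <= B z)%E by rewrite lee_fin; apply: mulr_ge0 => //; exact: sqr_ge0.
have KE v : (\int[mu]_w (poisson t e (w - v))%:E = K%:E)%E by exact: integral_poisson.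
have slice (f : R * R -> \bar R) v : measurable_fun setT f ->
    measurable_fun setT (fun w => f (v, w)).
  by move=> mf; exact: (measurableT_comp mf (pair1_measurable v)).
apply: (@le_trans _ _ (\int[mu]_v (\int[mu]_w A (v, w) + \int[mu]_w B (v, w)))%E).
  apply: ge0_le_integral => //.
  - by move=> v _; apply: integral_ge0 => w _; rewrite lee_fin.
  - apply: (@measurable_fun_fubini_tonelli_F _ _ _ _ _ mu (fun z : R * R =>
      (2 * (normc (G z.1) * (normc (G z.2) * poisson t e (z.2 - z.1))))%:E)).
      apply/measurable_EFinP/measurable_funM => //; apply: measurable_funM.
        exact: (measurableT_comp mG measurable_fst).
      apply: measurable_funM => //; exact: (measurableT_comp mG measurable_snd).
    by move=> z; rewrite lee_fin.
  - by apply: emeasurable_funD; exact: measurable_fun_fubini_tonelli_F.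
  move=> v _; rewrite -ge0_integralD//; try exact: slice.
  apply: ge0_le_integral => //.
  - by move=> w _; rewrite lee_fin.
  - apply/measurable_EFinP; apply: measurable_funM => //; apply: measurable_funM => //.
    by apply: measurable_funM => //; exact: measurable_poisson.
  - by apply: emeasurable_funD; exact: slice.
  move=> w _; rewrite -EFinD lee_fin /=.
  move: (poisson t e (w - v)) (P0 (w - v)) => p p0.
  rewrite -mulrDl !mulrA ler_wpM2r//.
  rewrite -subr_ge0 (_ : _ - _ = (normc (G v) - normc (G w)) ^+ 2) ?sqr_ge0//; ring.
rewrite ge0_integralD//; first last.
- exact: measurable_fun_fubini_tonelli_F.
- by move=> v _; apply: integral_ge0.
- exact: measurable_fun_fubini_tonelli_F.
- by move=> v _; apply: integral_ge0.
(* [A] is already integrated over the variable that occurs only in the kernel; for [B] the order has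
   to be exchanged, and the kernel being even, its mass is again [K]. *)
rewrite [X in (_ + X)%E](@fubini_tonelli _ _ _ _ _ mu mu _ mB B0).
have E1 v : (\int[mu]_w A (v, w) = K%:E * (normc (G v) ^+ 2)%:E)%E.
  under eq_integral do rewrite /A/= EFinM.
  rewrite ge0_integralZl_EFin ?sqr_ge0//.
  - by rewrite KE muleC.
  - by move=> w _; rewrite lee_fin.
  - by apply/measurable_EFinP; exact: measurable_poisson.
have E2 w : (\int[mu]_v B (v, w) = K%:E * (normc (G w) ^+ 2)%:E)%E.
  by rewrite -E1; apply: eq_integral => v _; rewrite /A /B /= poisson_sym.
under eq_integral do rewrite E1.
under [X in (_ + X <= _)%E]eq_integral do rewrite E2.
rewrite ge0_integralZl_EFin//; last 3 first.
- by move=> v _; rewrite lee_fin sqr_ge0.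
- exact/measurable_EFinP.
- by rewrite divr_ge0// mulr_ge0// pi_ge0.
by rewrite -ge0_muleDl ?lee_fin ?divr_ge0 ?mulr_ge0 ?pi_ge0// -EFinD mulr_natl mulr2n.
Qed.

(** The damping makes [psi] integrable, [ft t G] being merely bounded so far. The multiplication
    formula then turns the damped norm into a quadratic form in [G] with Poisson kernel. The 4
    collects the factor 2 of [normc_Cintegral], used twice; what matters is that the bound does not
    depend on [e]. *)
Lemma damped_norm_ft e : 0 < e ->
  \int[mu]_y (normc (ft t G y) ^+ 2 * exp_abs e y) <=
  4 * K * \int[mu]_v normc (G v) ^+ 2.
Proof.
move=> e0.
pose psi y := conjc (ft t G y) * (exp_abs e y)%:C.
have mft := cmeasurable_ft t G1.
have psi1 : cintegrable psi.
  apply: (@cintegrable_bounded _ (2 * \int[mu]_x normc (G x)) _ _ _ _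
    (cintegrable_exp_abs e0)).
    exact: cmeasurableJ.
  by move=> y; rewrite normcJ_real; exact: normc_ft.
have ci := cintegrable_mul_ft t psi1 G1.
have : Cintegral (fun y => ft t G y * psi y) =
    (\int[mu]_y (normc (ft t G y) ^+ 2 * exp_abs e y))%:C.
  rewrite -Cintegral_real; apply: eq_Cintegral => y.
  by rewrite /psi mulrA (mulrC (ft t G y)) mulJc; exact/esym/real_complexM.
rewrite ft_multiplication//.
move=> /(congr1 (@Normc.normc _)); rewrite normc_real => E.
apply: (le_trans (ler_norm _)); rewrite -E.
rewrite (@eq_Cintegral _ _ (fun v => ft t psi v * G v)) ; last by move=> v; rewrite mulrC.
apply: (le_trans (normc_Cintegral ci)).
rewrite (_ : 4 = 2 * 2); last by rewrite -natrM.
rewrite -[leRHS]mulrA -[leRHS]mulrA ler_wpM2l// mulrA.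
have iG2 := inL2_sqr G2.
rewrite -lee_fin EFinM (EFin_Rintegral iG2) (EFin_Rintegral (cintegrable_normc ci)).
apply: le_trans (poisson_quadratic_form e0).
have mG : measurable_fun setT (fun v => normc (G v)).
  by apply: measurable_normc; exact: inL2_measurable.
have mP v : measurable_fun setT (fun w => poisson t e (w - v)) by exact: measurable_poisson.
have P0 y : 0 <= poisson t e y by exact: poisson_ge0.
have iGP v : cintegrable (fun w => conjc (G w) * (poisson t e (w - v))%:C).
  have := @cintegrable_bounded _ (2 / e) _ (fun w => (poisson t e (w - v))%:C)
    (cmeasurable_real (mP v)) _ (cintegrableJ G1).
  under eq_fun do rewrite mulrC.
  by apply=> w; rewrite normc_real ger0_norm// poisson_le.
apply: ge0_le_integral => //.
- by move=> v _; rewrite lee_fin normc_ge0.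
- apply/measurable_EFinP; exact: rintegrable_measurable (cintegrable_normc ci).
- apply: (@measurable_fun_fubini_tonelli_F _ _ _ _ _ mu (fun z : R * R =>
    (2 * (normc (G z.1) * (normc (G z.2) * poisson t e (z.2 - z.1))))%:E)).
    apply/measurable_EFinP/measurable_funM => //; apply: measurable_funM.
      exact: (measurableT_comp mG measurable_fst).
    apply: measurable_funM; first exact: (measurableT_comp mG measurable_snd).
    exact: measurable_poisson2.
  by move=> z; rewrite lee_fin; exact: quadratic_form_ge0.
move=> v _; rewrite Normc.normcM ft_damped//.
have iN := rintegrableZl (2 * normc (G v)) (cintegrable_normc (iGP v)).
have -> : (\int[mu]_w (2 * (normc (G v) * (normc (G w) * poisson t e (w - v))))%:E =
    (2 * normc (G v) * \int[mu]_w normc (conjc (G w) * (poisson t e (w - v))%:C))%:E)%E.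
  rewrite -RintegralZl//; last exact: cintegrable_normc.
  rewrite (EFin_Rintegral iN).
  apply: eq_integral => w _; rewrite Normc.normcM normcJ_real normc_real ger0_norm//.
  by rewrite !mulrA.
rewrite lee_fin -mulrA mulrCA mulrC ler_wpM2l ?normc_ge0//.
exact: normc_Cintegral.
Qed.



(** The damped integrals increase as the damping [1 / (n + 1)] decreases to 0, and they share one
    bound, so monotone convergence applies. *)
Lemma inL2_ft : inL 2 (ft t G).
Proof.
have mft := cmeasurable_ft t G1.
have mf : measurable_fun setT (fun y => normc (ft t G y) ^+ 2).
  by apply: measurable_funX; exact: measurable_normc.
apply/inL2P; split => //; apply/integrableP; split; first exact/measurable_EFinP.
under eq_integral do rewrite /= ger0_norm ?sqr_ge0//.
pose f (n : nat) (y : R) : \bar R := (normc (ft t G y) ^+ 2 * exp_abs (harmonic n) y)%:E.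
have mfn n : measurable_fun setT (f n).
  apply/measurable_EFinP/measurable_funM => //; apply: continuous_measurable_fun.
  exact: continuous_exp_abs.
have f0 n y : setT y -> (0 <= f n y)%E.
  by move=> _; rewrite lee_fin mulr_ge0 ?sqr_ge0 ?exp_abs_ge0.
have ndf y : setT y -> nondecreasing_seq (f ^~ y).
  move=> _ m n mn; rewrite lee_fin ler_wpM2l ?sqr_ge0// ler_expR !mulNr lerN2.
  by rewrite ler_wpM2r// lef_pV2 ?posrE// ler_nat.
have fl y : limn (f ^~ y) = (normc (ft t G y) ^+ 2)%:E.
  apply/cvg_lim => //; apply: cvg_EFin; first exact: nearW.
  rewrite /= -[X in _ --> X]mulr1; apply: cvgM; first exact: cvg_cst.
  rewrite -expR0; apply: continuous_cvg; first exact: continuous_expR.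
  rewrite -[X in _ --> X](mul0r `|y|); apply: cvgM; last exact: cvg_cst.
  by rewrite -oppr0; apply: cvgN; exact: cvg_harmonic.
have fcvg := @cvg_monotone_convergence _ _ _ mu _ measurableT f mfn f0 ndf.
have -> : (\int[mu]_y (normc (ft t G y) ^+ 2)%:E =
    limn (fun n => \int[mu]_y f n y))%E.
  by rewrite (cvg_lim _ fcvg)//; apply: eq_integral => y _; rewrite fl.
apply: (@le_lt_trans _ _ (4 * K * \int[mu]_v normc (G v) ^+ 2)%:E); last exact: ltry.
apply: lime_le; first exact: cvgP fcvg.
apply: nearW => n; have h0 : 0 < harmonic n :> R by rewrite invr_gt0.
have := damped_norm_ft h0; rewrite -lee_fin; apply: le_trans.
rewrite EFin_Rintegral//.
(* The real integral in the bound represents the extended one only if the damped integrand is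
   integrable; it is a bounded function times [exp_abs]. *)
apply: (le_rintegrable _ (rintegrableZl ((2 * \int[mu]_x normc (G x)) ^+ 2)
  (rintegrable_exp_abs h0))).
  by apply/measurable_EFinP; exact: mfn.
move=> y; rewrite ger0_norm ?mulr_ge0 ?sqr_ge0 ?exp_abs_ge0 ?normc_ge0//.
rewrite ler_wpM2r ?exp_abs_ge0// ler_sqr ?nnegrE ?normc_ge0 ?normc_ft//.
exact: le_trans (normc_ge0 _) (normc_ft t y G1).
Qed.

End square_integrability.
End bessel.

(** * Fourier pairs and the inversion formula *)

Section fourier_pairs.
Context {R : realType}.
Let mu := @lebesgue_measure R.
Local Notation normc := Normc.normc.
Implicit Types (F G phi : R -> R[i]) (e x y v w : R).
Variable s : R.
Hypothesis s0 : s != 0.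

(* The weak form of "G is the Fourier-Plancherel transform of F": it survives
   L^2 limits and may be tested against explicit functions. *)
Definition fourier_pair F G := forall phi, cintegrable phi -> inL 2 phi ->
  Cintegral (fun x => F x * ft s phi x) = Cintegral (fun v => G v * phi v).

(** For each [h k] the relation is the multiplication formula. Both sides are continuous in the L^2
    norm by Cauchy-Schwarz, which on the left requires [ft s phi] in L^2: this is the first use of
    Bessel's inequality. *)
Lemma fourier_pair_lim F G (h : nat -> R -> R[i]) : inL 2 F -> inL 2 G ->
  (forall k, cintegrable (h k)) -> (forall k, inL 2 (h k)) ->
  norm2 (fun x => h k x - F x) @[k --> \oo] --> 0 ->
  norm2 (fun v => ft s (h k) v - G v) @[k --> \oo] --> 0 ->
  fourier_pair F G.
Proof.
move=> F2 G2 h1 h2 hF hG phi phi1 phi2.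
have fphi2 := inL2_ft s0 phi1 phi2.
have fh2 k := inL2_ft s0 (h1 k) (h2 k).
apply/eqP; rewrite -subr_eq0 -normc_eq0 -normr_le0; apply/ler_addgt0Pr => r r0.
rewrite add0r ger0_norm ?normc_ge0//.
pose u k := 2 * (norm2 (fun x => h k x - F x) * norm2 (ft s phi)) +
  2 * (norm2 (fun v => ft s (h k) v - G v) * norm2 phi).
have ucvg : u k @[k --> \oo] --> 0.
  have -> : (0 : R) = 2 * (0 * norm2 (ft s phi)) + 2 * (0 * norm2 phi) by ring.
  by apply: cvgD; apply: cvgMr; exact: cvgMl.
have [k _ /(_ k (leqnn k)) uk] := (cvgr0Pnorm_le _).1 ucvg r r0.
apply: le_trans (le_trans (ler_norm _) uk); rewrite /u.
(* The terms in [h k] cancel by the multiplication formula. *)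
have -> : Cintegral (fun x => F x * ft s phi x) - Cintegral (fun v => G v * phi v) =
  - Cintegral (fun x => (h k x - F x) * ft s phi x) +
    Cintegral (fun v => (ft s (h k) v - G v) * phi v).
  rewrite (@eq_Cintegral _ (fun x => (h k x - F x) * ft s phi x)
    (fun x => h k x * ft s phi x - F x * ft s phi x)); last by move=> x; rewrite mulrBl.
  rewrite (@eq_Cintegral _ (fun x => (ft s (h k) x - G x) * phi x)
    (fun x => ft s (h k) x * phi x - G x * phi x)); last by move=> x; rewrite mulrBl.
  rewrite !CintegralB; try exact: inL2M.
  by rewrite ft_multiplication//; ring.
apply: (le_trans (le_normcD _ _)); rewrite normcN.
by apply: lerD; apply: normc_Cintegral_L2 => //; exact: inL2B.
Qed.

Section inversion.
Variables (F G : R -> R[i]).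
Hypotheses (F2 : inL 2 F) (G2 : inL 2 G) (G1 : cintegrable G)
  (vG1 : cintegrable (fun v => v%:C * G v)) (FG : fourier_pair F G).
Let K : R := 2 * pi / `|s|.

Lemma inL2_poisson e x : 0 < e -> inL 2 (fun y => (poisson s e (y - x))%:C).
Proof.
move=> e0; have mP := measurable_poisson x s0 e0.
apply/inL2P; split; first exact: cmeasurable_real.
apply: (le_rintegrable _ (rintegrableZl (2 / e) (rintegrable_poisson x s0 e0))).
  by apply: measurable_funX; apply: measurable_normc; exact: cmeasurable_real.
move=> y; rewrite ger0_norm ?sqr_ge0// normc_real ger0_norm ?poisson_ge0// expr2.
by apply: ler_wpM2r; [exact: poisson_ge0|exact: poisson_le].
Qed.

Lemma inL2_exp_abs e : 0 < e -> inL 2 (fun v => (exp_abs e v)%:C).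
Proof.
move=> e0; have mP : measurable_fun setT (exp_abs e).
  by apply: continuous_measurable_fun; exact: continuous_exp_abs.
apply/inL2P; split; first exact: cmeasurable_real.
apply: (le_rintegrable _ (rintegrable_exp_abs e0)).
  by apply: measurable_funX; apply: measurable_normc; exact: cmeasurable_real.
move=> y; rewrite ger0_norm ?sqr_ge0// normc_real ger0_norm ?exp_abs_ge0// expr2.
rewrite ler_piMl ?exp_abs_ge0// -expR0 ler_expR mulNr oppr_le0.
by rewrite mulr_ge0// ltW.
Qed.

Lemma poisson_mean e x : 0 < e ->
  Cintegral (fun y => F y * (poisson s e (y - x))%:C) =
  Cintegral (fun v => G v * (expi (- s * x * v) * (exp_abs e v)%:C)).
Proof.
move=> e0; rewrite -FG.
- by apply: eq_Cintegral => y; rewrite ft_expi_exp_abs.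
- exact: cintegrable_expi_exp_abs.
- apply: (@inL2_bounded _ 1 _ _ _ _ (inL2_exp_abs e0)).
    by apply: cmeasurable_expi; exact: measurable_funM.
  by move=> v; rewrite normc_expi.
Qed.

(* 1 - exp (- e |v|) <= e |v| *)
Lemma poisson_mean_ft e x : 0 < e ->
  normc (Cintegral (fun y => F y * (poisson s e (y - x))%:C) - ft (- s) G x) <=
  e * (2 * \int[mu]_v normc (v%:C * G v)).
Proof.
move=> e0; rewrite poisson_mean// /ft.
have i1 : cintegrable (fun v => G v * (expi (- s * x * v) * (exp_abs e v)%:C)).
  apply: inL2M => //; apply: (@inL2_bounded _ 1 _ _ _ _ (inL2_exp_abs e0)).
    by apply: cmeasurable_expi; exact: measurable_funM.
  by move=> v; rewrite normc_expi.
rewrite -CintegralB//; last exact: cintegrable_ft.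
rewrite mulrCA -RintegralZl//; last exact: cintegrable_normc.
apply: normc_Cintegral_le.
- by apply: cintegrableB => //; exact: cintegrable_ft.
- by apply: rintegrableZl; exact: cintegrable_normc.
move=> v; rewrite [X in normc X](_ : _ = expi (- s * x * v) * ((exp_abs e v - 1)%:C * G v)); last first.
  rewrite (mulrAC (- s)); apply: complex_ext;
    rewrite /= ?(Re_mulc, Im_mulc, Re_addc, Im_addc, Re_oppc, Im_oppc)/=; ring.
rewrite !Normc.normcM normc_expi mul1r !normc_real mulrA ler_wpM2r ?normc_ge0//.
rewrite distrC ger0_norm; last first.
  by rewrite subr_ge0 -expR0 ler_expR mulNr oppr_le0 mulr_ge0// ltW.
have := expR_ge1Dx (- e * `|v|); rewrite /exp_abs; lra.
Qed.

(** Near [x] the integrand is at most [r] times the kernel, of mass [K]. Away from [x], [F] is only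
    square integrable, so a fixed integrable majorant is needed: there the kernel of width [e] is at
    most [e * C] times the kernel of width 1, which is in L^2 and hence integrable against [F]. *)
Lemma poisson_mean_cvg x (r : R) : continuous (re F) -> continuous (im F) -> 0 < r ->
  exists B : R, forall e, 0 < e -> e <= 1 ->
  normc (Cintegral (fun y => F y * (poisson s e (y - x))%:C) - K%:C * F x) <=
  2 * (r * K) + e * B.
Proof.
move=> cre cim r0.
have [d d0 Fd] : exists2 d, 0 < d & forall y, `|y - x| < d -> normc (F y - F x) <= r.
  have r2 : 0 < r / 2 by rewrite divr_gt0.
  have /cvgrPdist_le /(_ _ r2) [d1 /= d10 H1] := cre x.
  have /cvgrPdist_le /(_ _ r2) [d2 /= d20 H2] := cim x.
  exists (Num.min d1 d2); first by rewrite lt_min d10.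
  move=> y; rewrite lt_min distrC => /andP[/H1 h1 /H2 h2].
  apply: (le_trans (ler_normc_ReIm _)); rewrite Re_addc Im_addc Re_oppc Im_oppc.
  rewrite (splitr r) distrC; apply: lerD => //.
  by rewrite distrC.
(* With [S = s^2] and [Y = (y - x)^2 >= d^2], the constant comes from [2 e / (S Y) = e (1 + 1 / (S
   Y)) * 2 / (1 + S Y)], whose last factor is the kernel of width 1. *)
pose C := 1 + (s ^+ 2 * d ^+ 2)^-1.
have sd0 : 0 < s ^+ 2 * d ^+ 2 by apply: mulr_gt0; [rewrite exprn_even_gt0|exact: exprn_gt0].
have C0 : 0 <= C by rewrite addr_ge0// invr_ge0 ltW.
have FP : rintegrable (fun y => normc (F y) * poisson s 1 (y - x)).
  have := cintegrable_normc (inL2M F2 (inL2_poisson x ltr01)).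
  by under eq_fun do rewrite Normc.normcM normc_real ger0_norm ?poisson_ge0//.
have P1 : rintegrable (fun y => normc (F x) * poisson s 1 (y - x)).
  by apply: rintegrableZl; exact: rintegrable_poisson.
exists (2 * (C * \int[mu]_y
  (normc (F y) * poisson s 1 (y - x) + normc (F x) * poisson s 1 (y - x)))).
move=> e e0 e1.
have iP := rintegrable_poisson x s0 e0.
have KE : \int[mu]_y poisson s e (y - x) = K.
  by rewrite /Rintegral integral_poisson.
have -> : K%:C * F x = Cintegral (fun y => F x * (poisson s e (y - x))%:C).
  rewrite CintegralZl; last exact: cintegrable_real.
  by rewrite Cintegral_real KE mulrC.
rewrite -CintegralB; last 2 first.
- by apply: inL2M => //; exact: inL2_poisson.
- by apply: cintegrableZl; exact: cintegrable_real.
rewrite [e * _]mulrCA -mulrDr.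
rewrite -KE -RintegralZl// mulrA -RintegralZl//; last exact: rintegrableD.
rewrite -RintegralD//; last 2 first.
- exact: rintegrableZl.
- by apply: rintegrableZl; exact: rintegrableD.
apply: normc_Cintegral_le.
- apply: cintegrableB; first by apply: inL2M => //; exact: inL2_poisson.
  by apply: cintegrableZl; exact: cintegrable_real.
- apply: rintegrableD; first exact: rintegrableZl.
  by apply: rintegrableZl; exact: rintegrableD.
move=> y; rewrite -mulrBl Normc.normcM normc_real ger0_norm ?poisson_ge0//.
have P0 := poisson_ge0 s (y - x) e0; have P10 := poisson_ge0 s (y - x) (@ltr01 R).
have eC0 : 0 <= e * C by rewrite mulr_ge0// ltW.
have Fx0 := normc_ge0 (F x); have Fy0 := normc_ge0 (F y).
have [yx|yx] := ltP `|y - x| d.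
  apply: (@le_trans _ _ (r * poisson s e (y - x))); first by rewrite ler_wpM2r// Fd.
  by rewrite lerDl mulr_ge0// addr_ge0// mulr_ge0.
apply: (@le_trans _ _ ((normc (F y) + normc (F x)) * poisson s e (y - x))).
  by rewrite ler_wpM2r// (le_trans (le_normcD _ _))// normcN.
apply: (@le_trans _ _ (e * C * ((normc (F y) + normc (F x)) * poisson s 1 (y - x)))); last first.
  by rewrite mulrDl lerDr mulr_ge0// ltW.
rewrite [leRHS]mulrCA; apply: ler_wpM2l; first exact: addr_ge0.
rewrite /poisson /C exprMn expr1n.
have : d ^+ 2 <= (y - x) ^+ 2.
  by rewrite -[(y - x) ^+ 2]real_normK ?num_real// ler_sqr ?nnegrE// ltW.
have : 0 < s ^+ 2 by rewrite exprn_even_gt0.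
have : 0 < d ^+ 2 by rewrite exprn_gt0.
move: (s ^+ 2) (d ^+ 2) ((y - x) ^+ 2) => S D Y D0 S0 DY.
have Y0 : 0 < Y by exact: lt_le_trans DY.
have [SY0 SD0] : 0 < S * Y /\ 0 < S * D by split; exact: mulr_gt0.
have SY1 : 0 < 1 + S * Y by rewrite ltr_pwDl// ltW.
apply: (@le_trans _ _ (2 * e / (S * Y))).
  rewrite ler_wpM2l ?mulr_ge0 ?(ltW e0)// lef_pV2 ?posrE//.
    by rewrite lerDr sqr_ge0.
  by rewrite ltr_wpDl// sqr_ge0.
have -> : 2 * e / (S * Y) = e * (1 + (S * Y)^-1) * (2 * 1 / (1 + S * Y)).
  by field; rewrite !gt_eqF.
rewrite ler_wpM2r ?divr_ge0 ?(ltW SY1)// ler_wpM2l ?(ltW e0)// lerD2l.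
by rewrite lef_pV2 ?posrE// ler_wpM2l// ltW.
Qed.

Lemma fourier_inversion x : continuous (re F) -> continuous (im F) ->
  K%:C * F x = ft (- s) G x.
Proof.
move=> cre cim; have K0 : 0 < K by rewrite divr_gt0 ?normr_gt0// mulr_gt0// pi_gt0.
apply/eqP; rewrite -subr_eq0 -normc_eq0 -normr_le0; apply/ler_addgt0Pr => q q0.
rewrite add0r ger0_norm ?normc_ge0//.
(* This makes [2 (r K) = q / 2]; the terms linear in [e] get the other half, and the 1 in [B']
   serves to keep [B'] positive. *)
pose r := q / (4 * K); have r0 : 0 < r by rewrite divr_gt0// mulr_gt0.
have [B HB] := poisson_mean_cvg x cre cim r0.
pose B' := `|B| + `|2 * \int[mu]_v normc (v%:C * G v)| + 1.
have B'0 : 0 < B' by rewrite ltr_wpDl// addr_ge0.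
pose e := Num.min 1 (q / (2 * B')).
have e0 : 0 < e by rewrite lt_min ltr01 divr_gt0// mulr_gt0.
have e1 : e <= 1 by rewrite ge_min lexx.
have eq : e * B' <= q / 2.
  have : e <= q / (2 * B') by rewrite ge_min lexx orbT.
  by rewrite !ler_pdivlMr ?mulr_gt0// -mulrA [B' * 2]mulrC.
have -> : K%:C * F x - ft (- s) G x =
   - (Cintegral (fun y => F y * (poisson s e (y - x))%:C) - K%:C * F x) +
   (Cintegral (fun y => F y * (poisson s e (y - x))%:C) - ft (- s) G x) by ring.
apply: (le_trans (le_normcD _ _)); rewrite normcN.
apply: (le_trans (lerD (HB e e0 e1) (poisson_mean_ft x e0))).
rewrite -addrA -mulrDr [leRHS](splitr q); apply: lerD.
  by rewrite (_ : 2 * (r * K) = q / 2)// /r; field; rewrite gt_eqF.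
apply: le_trans eq; rewrite ler_wpM2l ?(ltW e0)// /B'.
rewrite (le_trans (lerD (ler_norm _) (ler_norm _)))// lerDl//.
Qed.


End inversion.
End fourier_pairs.

(** * Complex derivatives *)

Section complex_derivative.
Context {R : realType}.
Let mu := @lebesgue_measure R.
Local Notation normc := Normc.normc.
Implicit Types (f g w : R -> R[i]) (x y v : R).

(** Unlike an equation on [Cderive], which is total, this includes differentiability. *)
Definition cderives f f' := forall x : R,
  is_derive x 1 (re f) (complex.Re (f' x)) /\ is_derive x 1 (im f) (complex.Im (f' x)).

Lemma Cderive_cderives f f' x : cderives f f' -> Cderive f x = f' x.
Proof.
by move=> /(_ x)[df dg]; rewrite /Cderive !derive1E !derive_val; case: (f' x).
Qed.

Lemma cderives_continuous f f' : cderives f f' -> continuous (re f) /\ continuous (im f).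
Proof.
by move=> df; split=> x; have [d1 d2] := df x;
  apply: differentiable_continuous; apply/derivable1_diffP; exact: ex_derive.
Qed.

Lemma cderivesM f f' g g' : cderives f f' -> cderives g g' ->
  cderives (fun x => f x * g x) (fun x => f' x * g x + f x * g' x).
Proof.
move=> df dg x; have [rf jf] := df x; have [rg jg] := dg x; split.
  rewrite (_ : re _ = (fun y => re f y * re g y - im f y * im g y)).
    apply: is_derive_eq; rewrite /GRing.scale/= /re /im Re_addc !Re_mulc; ring.
  by apply/funext => y; rewrite /re/= Re_mulc.
rewrite (_ : im _ = (fun y => re f y * im g y + im f y * re g y)).
  apply: is_derive_eq; rewrite /GRing.scale/= /re /im Im_addc !Im_mulc; ring.
by apply/funext => y; rewrite /im/= Im_mulc.
Qed.

Lemma cderivesJ f f' : cderives f f' ->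
  cderives (fun x => conjc (f x)) (fun x => conjc (f' x)).
Proof.
move=> df x; have [rf jf] := df x; split.
  by rewrite (_ : re _ = re f) ?Re_conjc//; apply/funext => y; rewrite /re/= Re_conjc.
rewrite (_ : im _ = (fun y => - im f y)).
  by apply: is_derive_eq; rewrite Im_conjc.
by apply/funext => y; rewrite /im/= Im_conjc.
Qed.

Lemma cderives_cst (z : R[i]) : cderives (cst z) (cst 0).
Proof. by move=> x; split; rewrite /re/im/=; exact: is_derive_cst. Qed.

Lemma cderives_expi (r r' : R -> R) : (forall x, is_derive x 1 r (r' x)) ->
  cderives (fun x => expi (r x)) (fun x => (0 +i* r' x) * expi (r x)).
Proof.
move=> dr x; have drx := dr x; split.
  rewrite (_ : re _ = cos \o r)//.
  apply: is_derive_eq (is_derive1_comp (is_derive_cos _) drx) _.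
  by rewrite /=; ring.
rewrite (_ : im _ = sin \o r)//.
apply: is_derive_eq (is_derive1_comp (is_derive_sin _) drx) _.
by rewrite /=; ring.
Qed.

Section ft_derivative.
Variables (t : R) (G : R -> R[i]).
Hypotheses (G1 : cintegrable G) (vG1 : cintegrable (fun v => v%:C * G v)).

(** Differentiation under the integral sign, with majorant [|t| |v G v|] independent of the point;
    this is what the first moment has to be integrable for. *)
Lemma re_ft_derive x :
  is_derive x 1 (re (ft t G)) (complex.Re ((0 +i* t) * ft t (fun v => v%:C * G v) x)).
Proof.
pose f x v := complex.Re (expi (t * v * x) * G v).
have df x' v : is_derive x' 1 (f ^~ v)
    (complex.Re ((0 +i* t) * (expi (t * v * x') * (v%:C * G v)))).
  have -> : f^~ v = fun y => cos (t * v * y) * complex.Re (G v) -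
      sin (t * v * y) * complex.Im (G v).
    by apply/funext => w; rewrite /f Re_mulc.
  apply: is_derive_eq; rewrite /GRing.scale/= ?(Re_mulc, Im_mulc)/=; ring.
have d1 x' v : partial1of2 f x' v =
    complex.Re ((0 +i* t) * (expi (t * v * x') * (v%:C * G v))).
  by rewrite partial1of2E derive_val.
have Ix : `]x - 1, x + 1[%classic x by rewrite /= in_itv/= ltrDl gtrDl ltrN10 ltr01.
have h1 (x' : R) : `]x - 1, x + 1[%classic x' -> mu.-integrable setT (EFin \o f x').
  by move=> _; have [] := cintegrable_ft t x' G1.
have h2 (x' y : R) : `]x - 1, x + 1[%classic x' -> setT y -> derivable (f ^~ y) x' 1.
  by move=> _ _; exact: ex_derive.
pose D v := `|t| * normc (v%:C * G v).
have D0 v : 0 <= D v by rewrite mulr_ge0// normc_ge0.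
have iD : mu.-integrable setT (EFin \o D).
  by apply: rintegrableZl; exact: cintegrable_normc.
have h3 (x' y : R) : `]x - 1, x + 1[%classic x' -> setT y ->
    `|partial1of2 f x' y| <= D y.
  move=> _ _; rewrite d1; apply: (le_trans (ler_Re_normc _)).
  rewrite Normc.normcM [X in X * _]/= expr0n/= add0r sqrtr_sqr ler_wpM2l//.
  by rewrite Normc.normcM normc_expi mul1r.
have dU := @derivable_under_integral _ _ _ mu f setT measurableT x _ _ Ix h1 h2 D D0 iD h3.
have eU := @differentiation_under_integral _ _ _ mu f setT measurableT x _ _ Ix h1 h2 D D0 iD h3.
apply: DeriveDef; first exact: dU.
rewrite -derive1E eU.
under eq_Rintegral do rewrite d1.
rewrite /ft -CintegralZl//; exact: cintegrable_ft.
Qed.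

End ft_derivative.

Lemma cderives_ft (t : R) G : cintegrable G -> cintegrable (fun v => v%:C * G v) ->
  cderives (ft t G) (fun x => (0 +i* t) * ft t (fun v => v%:C * G v) x).
Proof.
move=> G1 vG1 x; split; first exact: re_ft_derive.
rewrite im_ft.
have i1 : cintegrable (fun x => - 'i * G x) by exact: cintegrableZl.
have i2 : cintegrable (fun v => v%:C * (- 'i * G v)).
  have := cintegrableZl (- 'i) vG1.
  by under eq_fun do rewrite mulrCA.
apply: is_derive_eq (re_ft_derive t i1 i2 x) _.
have -> : ft t (fun v => v%:C * (- 'i * G v)) x = - 'i * ft t (fun v => v%:C * G v) x.
  rewrite /ft -CintegralZl; last exact: cintegrable_ft.
  by apply: eq_Cintegral => v; rewrite !(mulrCA (- 'i)).
by case: (ft t _ x) => p q /=; ring.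
Qed.

End complex_derivative.

(** * Integration by parts on the line *)

Section integral_derivative.
Context {R : realType}.
Let mu := @lebesgue_measure R.
Local Notation normc := Normc.normc.

Section real_valued.
Variables w dw : R -> R.
Hypotheses (dwE : forall x : R, is_derive x 1 w (dw x)) (cdw : continuous dw)
  (iw : rintegrable w) (idw : rintegrable dw).

Let J (T : R) := `[- T, T]%classic : set R.

Lemma increment_integral (T : R) : 0 < T -> w T - w (- T) = \int[mu]_(x in J T) dw x.
Proof.
move=> T0.
have cw : continuous w.
  move=> x; have := dwE x => ?; apply: differentiable_continuous.
  by apply/derivable1_diffP; exact: ex_derive.
rewrite /Rintegral (@continuous_FTC2 _ dw w)//.
- by rewrite ltrNl (lt_trans _ T0)// oppr_lt0.
- exact: continuous_subspaceT.
- split.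
  + by move=> x _; have := dwE x => ?; exact: ex_derive.
  + by apply: cvg_at_right_filter; exact: cw.
  + by apply: cvg_at_left_filter; exact: cw.
- by move=> x _; have := dwE x => ?; rewrite derive1E derive_val.
Qed.

Lemma increment_dist (S T : R) : 0 < S -> S <= T ->
  `|\int[mu]_x dw x - (w T - w (- T))| <= \int[mu]_(x in ~` J S) `|dw x|.
Proof.
move=> S0 ST; rewrite increment_integral; last exact: lt_le_trans ST.
have mJ U : measurable (J U) by exact: measurable_itv.
have mJC U : measurable (~` J U) by exact: measurableC.
have idwA A : measurable A -> mu.-integrable A (EFin \o dw).
  by move=> mA; apply: integrableS idw.
have -> : \int[mu]_x dw x = \int[mu]_(x in J T) dw x + \int[mu]_(x in ~` J T) dw x.
  by rewrite -Rintegral_setU ?setUv//; [exact: mJ|exact: mJC|exact/disj_setPCl].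
rewrite addrAC subrr add0r.
apply: le_trans.
  by apply: le_normr_Rintegral; [exact: mJC|apply: idwA; exact: mJC].
apply: fine_le.
- apply: integrable_fin_num; first exact: mJC.
  by apply: integrable_norm; apply: idwA; exact: mJC.
- apply: integrable_fin_num; first exact: mJC.
  by apply: integrable_norm; apply: idwA; exact: mJC.
apply: ge0_subset_integral; [exact: mJC|exact: mJC| |by []|].
  apply/measurable_EFinP; apply: measurable_funTS; apply: measurableT_comp => //.
  exact: rintegrable_measurable.
apply: subsetC => x; rewrite /J /= !in_itv/= => /andP[Sx xS].
by rewrite (le_trans xS ST) (le_trans _ Sx)// lerN2.
Qed.

(** The integrals of [|dw|] over [J n.+1%:R] increase to the full integral; the shift by one keeps
    the cut-off positive. *)
Lemma tail_small (r : R) : 0 < r ->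
  exists2 S : R, 0 < S & \int[mu]_(x in ~` J S) `|dw x| <= r.
Proof.
move=> r0.
have mJ U : measurable (J U) by exact: measurable_itv.
have mJC U : measurable (~` J U) by exact: measurableC.
have mdw : measurable_fun setT (fun x => (`|dw x|)%:E).
  apply/measurable_EFinP; apply: measurableT_comp => //; exact: rintegrable_measurable.
have indw := integrable_norm idw.
have fin A : measurable A -> (\int[mu]_(x in A) (`|dw x|)%:E)%E \is a fin_num.
  by move=> mA; apply: integrable_fin_num => //; apply: integrableS indw.
have : (\int[mu]_(x in J n.+1%:R) (`|dw x|)%:E)%E @[n --> \oo] -->
    (\int[mu]_x (`|dw x|)%:E)%E.
  have <- : \bigcup_i J i.+1%:R = setT.
    apply/seteqP; split=> // x _; exists (Num.truncn `|x|) => //.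
    by rewrite /J /= in_itv/= -ler_norml ltW// truncnS_gt.
  apply: ge0_nondecreasing_set_cvg_integral.
  - move=> n m nm; rewrite subsetEset => x; rewrite /J /= !in_itv/= -!ler_norml => xn.
    by rewrite (le_trans xn)// ler_nat.
  - by move=> n; exact: mJ.
  - by move=> n; exact: measurable_funTS.
  - by move=> n x _; rewrite lee_fin.
rewrite -(fineK (fin _ measurableT)) => /fine_cvgP[_].
move=> /cvgrPdist_le /(_ _ r0) [n _ /(_ n (leqnn n)) /= H].
exists n.+1%:R; first by rewrite ltr0n.
apply: le_trans H; apply: le_trans (ler_norm _).
rewrite [X in _ <= X - _](_ : _ = \int[mu]_(x in J n.+1%:R) `|dw x| +
   \int[mu]_(x in ~` J n.+1%:R) `|dw x|).
  by rewrite addrAC subrr add0r.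
by rewrite -Rintegral_setU ?setUv//; [exact: mJ|exact: mJC|exact/disj_setPCl].
Qed.

Lemma rintegrable_opp (u : R -> R) : rintegrable u -> rintegrable (fun x => u (- x)).
Proof.
move=> iu; have mu' := rintegrable_measurable iu.
have mN : measurable_fun setT (-%R : R -> measurableTypeR R) by [].
apply/integrableP; split; first by apply/measurable_EFinP; exact: measurableT_comp.
have /integrableP[_] := iu; apply: le_lt_trans.
rewrite [leRHS](_ : _ =
    \int[pushforward mu (-%R : R -> measurableTypeR R)]_x `|(u x)%:E|)%E.
  rewrite ge0_integral_pushforward//.
  by apply: measurableT_comp => //; exact/measurable_EFinP.
by apply: eq_measure_integral => A mA _; exact/esym/lebesgue_measureN.
Qed.

(* The increments [w T - w (- T)] converge to [\int dw] and are integrable in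
   [T], so their limit is 0. *)
Lemma Rintegral_derivative : \int[mu]_x dw x = 0.
Proof.
apply/eqP; apply/negPn/negP => L0; set L := \int[mu]_x dw x in L0.
(* For [x >= S] the increment lies within [|L| / 2] of [L], so [u x >= |L| / 2] on a half-line of
   infinite measure, although [u] is integrable. *)
have r0 : 0 < `|L| / 2 by rewrite divr_gt0// normr_gt0.
have [S S0 HS] := tail_small r0.
pose u x := `|w x| + `|w (- x)|.
have iu : rintegrable u.
  by apply: rintegrableD; apply: integrable_norm => //; exact: rintegrable_opp.
have u0 x : 0 <= u x by rewrite addr_ge0.
have : (\int[mu]_(x in `[S, +oo[) (u x)%:E < +oo)%E.
  have /integrableP[_] := iu; apply: le_lt_trans.
  under [leRHS]eq_integral do rewrite /= ger0_norm//.
  apply: ge0_subset_integral => //.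
    by apply/measurable_EFinP; exact: rintegrable_measurable.
  by move=> x _; rewrite lee_fin.
apply/negP; rewrite -leNgt.
apply: (@le_trans _ _ (\int[mu]_(x in `[S, +oo[) cst (`|L| / 2)%:E x)%E).
  have mS : mu `[S, +oo[%classic = +oo%E by rewrite /mu lebesgue_measure_itv/= ltry.
  by rewrite integral_cst// [X in (_ * X)%E]mS gt0_muley// lte_fin.
apply: ge0_le_integral => //.
- by move=> x _; rewrite lee_fin ltW.
- apply/measurable_EFinP; apply: measurable_funTS; exact: rintegrable_measurable.
move=> x; rewrite /= in_itv/= andbT => Sx; rewrite lee_fin.
have := le_trans (increment_dist S0 Sx) HS; rewrite -/L => H.
have := ler_distD (w x - w (- x)) L 0; rewrite !subr0.
have := ler_normB (w x) (w (- x)); rewrite /u.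
move: H; set a := `|L - _|; set b := `|w x - _|; lra.
Qed.

End real_valued.
End integral_derivative.

(** * Plancherel's identity for the derivatives *)

Section plancherel.
Context {R : realType}.
Let mu := @lebesgue_measure R.
Local Notation normc := Normc.normc.
Implicit Types (f g : R -> R[i]).

Definition ccontinuous f := continuous (re f) /\ continuous (im f).

Lemma ccontinuous_cst (z : R[i]) : ccontinuous (cst z).
Proof. by split; exact: cst_continuous. Qed.

Lemma ccontinuousM f g : ccontinuous f -> ccontinuous g ->
  ccontinuous (fun x => f x * g x).
Proof.
move=> [rf jf] [rg jg]; split.
  rewrite (_ : re _ = (fun x => re f x * re g x - im f x * im g x)).
    by move=> x; apply: cvgB; apply: cvgM; [exact: rf|exact: rg|exact: jf|exact: jg].
  by apply/funext => x; rewrite /re/= Re_mulc.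
rewrite (_ : im _ = (fun x => re f x * im g x + im f x * re g x)).
  by move=> x; apply: cvgD; apply: cvgM; [exact: rf|exact: jg|exact: jf|exact: rg].
by apply/funext => x; rewrite /im/= Im_mulc.
Qed.

Lemma ccontinuousD f g : ccontinuous f -> ccontinuous g ->
  ccontinuous (fun x => f x + g x).
Proof.
move=> [rf jf] [rg jg]; split.
  rewrite (_ : re _ = (fun x => re f x + re g x)).
    by move=> x; apply: cvgD; [exact: rf|exact: rg].
  by apply/funext => x; rewrite /re/= Re_addc.
rewrite (_ : im _ = (fun x => im f x + im g x)).
  by move=> x; apply: cvgD; [exact: jf|exact: jg].
by apply/funext => x; rewrite /im/= Im_addc.
Qed.

Lemma ccontinuousJ f : ccontinuous f -> ccontinuous (fun x => conjc (f x)).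
Proof.
move=> [rf jf]; split.
  by rewrite (_ : re _ = re f)//; apply/funext => x; rewrite /re/= Re_conjc.
rewrite (_ : im _ = (fun x => - im f x)); first by move=> x; apply: cvgN; exact: jf.
by apply/funext => x; rewrite /im/= Im_conjc.
Qed.

Lemma Cintegral_derivative (f f' : R -> R[i]) : cderives f f' ->
  ccontinuous f' -> cintegrable f -> cintegrable f' ->
  Cintegral f' = 0.
Proof.
move=> df [cr ci] [rf jf] [rf' jf']; apply: complex_ext.
  by apply: (@Rintegral_derivative _ (re f)) => // x; have [] := df x.
by apply: (@Rintegral_derivative _ (im f)) => // x; have [] := df x.
Qed.

(** No boundary terms occur: the product and its derivative are integrable, so the derivative has
    integral 0. *)
Lemma Cintegral_by_parts f f' g g' : cderives f f' -> cderives g g' ->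
  ccontinuous f' -> ccontinuous g' ->
  cintegrable (fun x => f x * g x) -> cintegrable (fun x => f' x * g x) ->
  cintegrable (fun x => f x * g' x) ->
  Cintegral (fun x => f' x * g x) = - Cintegral (fun x => f x * g' x).
Proof.
move=> df dg cf' cg' fg f'g fg'; apply/eqP; rewrite -subr_eq0 opprK -CintegralD//.
apply/eqP/(Cintegral_derivative (cderivesM df dg)) => //; last exact: cintegrableD.
have cf : ccontinuous f := cderives_continuous df.
have cg : ccontinuous g := cderives_continuous dg.
by apply: ccontinuousD; exact: ccontinuousM.
Qed.

Section derivative_chain.
Variables (c : R) (V : nat -> R -> R[i]).
Hypotheses (c0 : c != 0)
  (dV : forall n, cderives (V n) (fun x => (0 +i* c) * V n.+1 x))
  (V2 : forall n, inL 2 (V n)).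

(** Symmetry of [- i d/dx]: the sign from integration by parts is absorbed by conjugating the
    imaginary factor [0 +i* c]. *)
Lemma derivative_chain_shift i j :
  Cintegral (fun x => V i.+1 x * conjc (V j x)) =
  Cintegral (fun x => V i x * conjc (V j.+1 x)).
Proof.
have cV n : ccontinuous (V n) := cderives_continuous (dV n).
have c0' : (0 +i* c) != 0 :> R[i] by rewrite eq_complex /= (negbTE c0) andbF.
have cV2 n : inL 2 (fun x => (0 +i* c) * V n x) by exact: inL2Zl.
have iV m n := inL2M (V2 m) (inL2J (V2 n)).
(* Multiplying by [0 +i* c] turns [V i.+1] into the derivative of [V i]. *)
apply: (mulfI c0').
rewrite -(CintegralZl _ (iV i.+1 j)).
rewrite (@eq_Cintegral _ _ (fun x => ((0 +i* c) * V i.+1 x) * conjc (V j x))); last first.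
  by move=> x; rewrite mulrA.
rewrite (Cintegral_by_parts (dV i) (cderivesJ (dV j))).
- rewrite -mulN1r -!CintegralZl.
  + apply: eq_Cintegral => x; rewrite conjcM.
    by case: (V i x) (V j.+1 x) => [? ?] [? ?]; apply: complex_ext => /=; ring.
  + exact: iV.
  + exact: inL2M (inL2J (cV2 _)).
- by apply: ccontinuousM; first exact: ccontinuous_cst.
- by apply: ccontinuousJ; apply: ccontinuousM; first exact: ccontinuous_cst.
- exact: iV.
- exact: inL2M (inL2J (V2 _)).
- exact: inL2M (inL2J (cV2 _)).
Qed.

Lemma derivative_chain_shiftn i j k :
  Cintegral (fun x => V (i + k)%N x * conjc (V j x)) =
  Cintegral (fun x => V i x * conjc (V (j + k)%N x)).
Proof.
elim: k i j => [|k IH] i j; first by rewrite !addn0.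
by rewrite addnS derivative_chain_shift IH addSnnS.
Qed.

End derivative_chain.

Definition moment (G : R -> R[i]) (n : nat) : R -> R[i] := fun v => (v ^+ n)%:C * G v.

(** * Moments of the transform and the norms of the derivatives *)

Section moments.
Variable G : R -> R[i].
Hypothesis GL2 : forall n, inL 2 (moment G n).

Lemma momentS n : moment G n.+1 = fun v => v%:C * moment G n v.
Proof. by apply/funext => v; rewrite /moment exprS real_complexM mulrA. Qed.

Lemma moment0 : moment G 0 = G.
Proof. by apply/funext => v; rewrite /moment expr0 mul1r. Qed.

(** [v^n G] is the product of [2 / (1 + v^2)], the Poisson kernel with unit parameters, and
    [(v^n G + v^(n+2) G) / 2]; both factors are in L^2. *)
Lemma cintegrable_moment n : cintegrable (moment G n).
Proof.
have p2 := @inL2_poisson R 1 (oner_neq0 _) 1 0 ltr01.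
have := inL2M p2 (inL2Zl (2^-1)%:C (inL2D (GL2 n) (GL2 n.+2))).
congr cintegrable; apply/funext => v; rewrite /moment /poisson.
have v0 : 1 + v ^+ 2 != 0 by rewrite gt_eqF// ltr_pwDl// sqr_ge0.
have E : (2 * 1 / (1 ^+ 2 + (1 * (v - 0)) ^+ 2)) * (2^-1 * (v ^+ n + v ^+ n.+2)) = v ^+ n.
  rewrite (_ : v ^+ n.+2 = v ^+ 2 * v ^+ n); last by rewrite -exprD.
  by rewrite subr0 mul1r expr1n; move: (v ^+ n) => w; field.
rewrite -[in RHS]E; case: (G v) => p q; apply: complex_ext; rewrite /=; ring.
Qed.

Variable s : R.
Hypothesis s0 : s != 0.
Let U n := ft (- s) (moment G n).
Let K : R := 2 * pi / `|s|.

Lemma inL2_ft_moment n : inL 2 (U n).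
Proof. by apply: inL2_ft; rewrite ?oppr_eq0//; exact: cintegrable_moment. Qed.

Lemma cderives_ft_moment n : cderives (U n) (fun x => (0 +i* - s) * U n.+1 x).
Proof.
rewrite /U momentS; apply: cderives_ft; first exact: cintegrable_moment.
by rewrite -momentS; exact: cintegrable_moment.
Qed.

Lemma fourier_inversion_moment F x : inL 2 F -> fourier_pair s F G ->
  continuous (re F) -> continuous (im F) -> K%:C * F x = U 0%N x.
Proof.
move=> F2 FG cr ci; rewrite /U moment0; apply: fourier_inversion => //.
- by rewrite -moment0; exact: GL2.
- by rewrite -moment0; exact: cintegrable_moment.
- by have := cintegrable_moment 1; rewrite momentS moment0.
Qed.

(** The weak relation is available for [F] and [G] themselves, not for their derivatives and
    moments. Hence the detour through total order [2 n]: the inner product of [U 0] with [U (n + n)]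
    is computed by the relation, and half of the order is then moved across. *)
Lemma norm2_ft_moment F n : inL 2 F -> continuous (re F) -> continuous (im F) ->
  fourier_pair s F G -> norm2 (U n) ^+ 2 = K * norm2 (moment G n) ^+ 2.
Proof.
move=> F2 cr ci FG.
have U0 x := fourier_inversion_moment x F2 FG cr ci.
have K0 : K != 0 by rewrite mulf_neq0 ?invr_eq0 ?normr_eq0// mulf_neq0// gt_eqF// pi_gt0.
have := FG _ (cintegrableJ (cintegrable_moment (n + n))) (inL2J (GL2 (n + n))).
rewrite (@eq_Cintegral _ (fun v => G v * _)
  (fun v => conjc (moment G n v) * moment G n v)); last first.
  move=> v; rewrite /moment exprD; case: (G v) => p q; apply: complex_ext => /=; ring.
rewrite Cintegral_mulJ => E.
(* The index is written [0 + n + n] to match the right-hand side of [derivative_chain_shiftn]. *)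
have {}E : Cintegral (fun x => U 0%N x * conjc (U (0 + n + n)%N x)) =
    (K * norm2 (moment G n) ^+ 2)%:C.
  rewrite real_complexM -E -CintegralZl.
    by apply: eq_Cintegral => x; rewrite mulrA U0 /U ftJ ?opprK//; exact: cintegrable_moment.
  apply: inL2M => //; apply: inL2_ft => //; last exact: inL2J.
  exact/cintegrableJ/cintegrable_moment.
have c0 : - s != 0 by rewrite oppr_eq0.
move: E; rewrite -(derivative_chain_shiftn c0 cderives_ft_moment inL2_ft_moment) !add0n.
rewrite (@eq_Cintegral _ _ (fun x => conjc (U n x) * U n x)); last by move=> x; rewrite mulrC.
by rewrite Cintegral_mulJ => -[].
Qed.

End moments.
End plancherel.

(** * Reduction of the transform to a Fourier transform *)

Section olct_fourier.
Context {R : realType}.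
Let mu := @lebesgue_measure R.
Local Notation normc := Normc.normc.
Variable M : olct_param R.
Local Notation a := (pa M).
Local Notation b := (pb M).
Local Notation d := (pd M).
Local Notation u0 := (pu0 M).
Local Notation w0 := (pw0 M).
Hypothesis b0 : b != 0.
Implicit Types (f g h : R -> R[i]) (x u : R).

Let s : R := - b^-1.
Let s0 : s != 0. Proof. by rewrite oppr_eq0 invr_eq0. Qed.

Definition olct_cst : R[i] :=
  sqrtc (1 / (0 +i* (2 * pi * b))) * expi ((2 * b)^-1 * (d * u0 ^+ 2)).
Definition chirp_in x : R[i] := expi ((2 * b)^-1 * (a * x ^+ 2 + 2 * x * u0)).
Definition chirp_out u : R[i] :=
  expi ((2 * b)^-1 * (- (2 * u * (d * u0 - b * w0)) + d * u ^+ 2)).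

Lemma olct_cst_neq0 : olct_cst != 0.
Proof.
rewrite mulf_neq0//; last by rewrite -normc_eq0 normc_expi oner_eq0.
rewrite sqrtc_eq0 mulf_neq0 ?oner_eq0// invr_eq0 eq_complex /= eqxx/=.
by rewrite !mulf_neq0// gt_eqF// pi_gt0.
Qed.

Lemma olct_kernelE u x :
  olct_kernel M u x = chirp_out u * (expi (s * x * u) * (olct_cst * chirp_in x)).
Proof.
have E : expi ((2 * b)^-1 * (a * x ^+ 2 + 2 * x * (u0 - u)
    - 2 * u * (d * u0 - b * w0) + d * u ^+ 2)) =
    chirp_out u * (expi (s * x * u) * chirp_in x).
  by rewrite -!expiD; congr expi; rewrite /s; field.
by rewrite /olct_kernel -/olct_cst E mulrCA (mulrCA olct_cst).
Qed.

Lemma measurable_chirp_in : cmeasurable chirp_in.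
Proof.
apply: cmeasurable_expi; apply: measurable_funM => //.
apply: measurable_funD; first by apply: measurable_funM => //; exact: measurable_funX.
by apply: measurable_funM => //; exact: measurable_funM.
Qed.

Lemma measurable_chirp_out : cmeasurable chirp_out.
Proof.
apply: cmeasurable_expi; apply: measurable_funM => //.
apply: measurable_funD; last by apply: measurable_funM => //; exact: measurable_funX.
by apply: measurableT_comp => //; apply: measurable_funM => //; exact: measurable_funM.
Qed.

Lemma normc_chirp_in x : normc (chirp_in x) = 1. Proof. exact: normc_expi. Qed.

Lemma normc_chirp_out u : normc (chirp_out u) = 1. Proof. exact: normc_expi. Qed.

Lemma chirp_outK u z : chirp_out u * (conjc (chirp_out u) * z) = z.
Proof.
rewrite mulrA (_ : chirp_out u * conjc (chirp_out u) = 1) ?mul1r//.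
by rewrite mulrC /chirp_out conjc_expi expiNK.
Qed.

Definition chirp_mul f x := olct_cst * (chirp_in x * f x).

Lemma cintegrable_chirp_mul f : cintegrable f -> cintegrable (chirp_mul f).
Proof.
move=> f1; apply: cintegrableZl.
apply: (@cintegrable_bounded _ 1) f1; first exact: measurable_chirp_in.
by move=> x; rewrite normc_chirp_in.
Qed.

Lemma inL2_chirp_mul f : inL 2 f -> inL 2 (chirp_mul f).
Proof.
move=> f2; apply: inL2Zl; apply: (@inL2_bounded _ 1) f2; first exact: measurable_chirp_in.
by move=> x; rewrite normc_chirp_in.
Qed.

Lemma olct_integralE h u : cintegrable h ->
  olct_integral M h u = chirp_out u * ft s (chirp_mul h) u.
Proof.
move=> h1; rewrite -CintegralZl; last by apply: cintegrable_ft; exact: cintegrable_chirp_mul.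
by apply: eq_Cintegral => x; rewrite olct_kernelE /chirp_mul !mulrA.
Qed.

Lemma LnormC_cvg0 (h : nat -> R -> R[i]) : (forall k, inL 2 (h k)) ->
  LnormC 2 (h k) @[k --> \oo] --> 0%E -> norm2 (h k) @[k --> \oo] --> 0.
Proof.
move=> h2; under eq_fun do rewrite LnormC_norm2//.
by move=> /fine_cvgP[_].
Qed.

Definition unchirp g u := conjc (chirp_out u) * g u.

Lemma inL2_unchirp g : inL 2 g -> inL 2 (unchirp g).
Proof.
apply: (@inL2_bounded _ 1); first by apply: cmeasurableJ; exact: measurable_chirp_out.
by move=> x; rewrite normcJ_real normc_chirp_out.
Qed.

(** The approximants in [is_olct] are integrable, so for them the transform is an honest Fourier
    integral. The chirps are unimodular, so L^2 convergence is kept, up to the factor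
    [normc olct_cst] on the input side. *)
Lemma olct_fourier_pair f g : is_olct M f g -> fourier_pair s (chirp_mul f) (unchirp g).
Proof.
case=> f2 g2 [h [h12 hf hg]].
have h1 k : cintegrable (h k) by apply/inL1P; have [] := h12 k.
have h2 k : inL 2 (h k) by have [] := h12 k.
have ft2 k : inL 2 (ft s (chirp_mul (h k))).
  by apply: inL2_ft => //; [exact: cintegrable_chirp_mul|exact: inL2_chirp_mul].
have olct2 k : inL 2 (olct_integral M (h k)).
  rewrite (_ : olct_integral _ _ =
      fun u => chirp_out u * ft s (chirp_mul (h k)) u); last first.
    by apply/funext => u; exact: olct_integralE.
  apply: (@inL2_bounded _ 1) => //; first exact: measurable_chirp_out.
  by move=> u; rewrite normc_chirp_out.
have {}hf := LnormC_cvg0 (fun k => inL2B (h2 k) f2) hf.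
have {}hg := LnormC_cvg0 (fun k => inL2B (olct2 k) g2) hg.
apply: (@fourier_pair_lim _ s s0 _ _ (fun k => chirp_mul (h k))).
- exact: inL2_chirp_mul.
- exact: inL2_unchirp.
- by move=> k; exact: cintegrable_chirp_mul.
- by move=> k; exact: inL2_chirp_mul.
- rewrite (_ : (fun k => _) = fun k => normc olct_cst * norm2 (fun x => h k x - f x)).
    by rewrite -[X in _ --> X](mulr0 (normc olct_cst)); apply: cvgM => //; exact: cvg_cst.
  apply/funext => k; rewrite -norm2Zl; last exact: inL2B.
  apply: eq_norm2 => x; rewrite /chirp_mul -mulrBr -mulrBr.
  rewrite [LHS]Normc.normcM [RHS]Normc.normcM (Normc.normcM (chirp_in x)).
  by rewrite normc_chirp_in mul1r.
- rewrite (_ : (fun k => _) = fun k => norm2 (fun u => olct_integral M (h k) u - g u))//.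
  apply/funext => k; apply: eq_norm2 => u.
  rewrite olct_integralE// -[in RHS](chirp_outK u (g u)) -mulrBr.
  by rewrite [RHS]Normc.normcM normc_chirp_out mul1r.
Qed.

Lemma cderives_chirp_in :
  cderives chirp_in (fun x => (0 +i* (b^-1 * (a * x + u0))) * chirp_in x).
Proof.
apply: cderives_expi => x.
apply: is_derive_eq; rewrite /GRing.scale/=; by field.
Qed.

(** The logarithmic derivative of the conjugate chirp is [- i (a x + u0) / b], which cancels the
    multiplication term of [Delta]; what is left is [- d/dx], conjugated by the chirp. *)
Lemma Delta_chirp (U U' : R -> R[i]) (k : R[i]) x : cderives U U' ->
  Delta M (fun x => k * (conjc (chirp_in x) * U x)) x =
  - (k * (conjc (chirp_in x) * U' x)).
Proof.
move=> dU; rewrite /Delta.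
have := cderivesM (cderives_cst k) (cderivesM (cderivesJ cderives_chirp_in) dU).
move=> /Cderive_cderives ->; rewrite conjcM.
by case: (chirp_in x) (U x) (U' x) k => [? ?] [? ?] [? ?] [? ?]; apply: complex_ext => /=; ring.
Qed.

Section iterates.
Variables (f g : R -> R[i]).
Hypotheses (f2 : inL 2 f) (cf : ccontinuous f) (fg : is_olct M f g)
  (gL2 : forall n, inL 2 (fun u => ((u / b) ^+ n)%:C * g u)).
Let K : R := 2 * pi / `|s|.
Let G := unchirp g.
Let U n := ft (- s) (moment G n).

Let K_gt0 : 0 < K.
Proof. by rewrite divr_gt0 ?normr_gt0// mulr_gt0// pi_gt0. Qed.

Let K_neq0 : K%:C != 0.
Proof. by rewrite -normc_eq0 normc_real normr_eq0 gt_eqF. Qed.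

Lemma ccontinuous_chirp_mul : ccontinuous (chirp_mul f).
Proof.
apply: ccontinuousM; first exact: ccontinuous_cst.
by apply: ccontinuousM => //; exact: cderives_continuous cderives_chirp_in.
Qed.

Lemma inL2_moment_unchirp n : inL 2 (moment G n).
Proof.
have g2 : inL 2 g by case: fg.
have mG : cmeasurable (moment G n).
  apply: cmeasurableM; last by apply: inL2_measurable; exact: inL2_unchirp.
  by apply: cmeasurable_real; exact: measurable_funX.
apply: (le_inL2 mG (inL2Zl ((b ^+ n)%:C) (gL2 n))) => u.
rewrite /moment /G /unchirp !Normc.normcM normcJ_real normc_chirp_out mul1r !normc_real.
by rewrite mulrA -normrM -exprMn mulrCA divff// mulr1.
Qed.

(** The base case is the inversion formula, at every [x]. In the induction step the derivative of
    [U n] brings a factor [- i s], whose sign cancels that of [Delta]. *)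
Lemma iter_Delta n : iter n (Delta M) f =
  fun x => (K%:C * olct_cst)^-1 * (0 +i* s) ^+ n * (conjc (chirp_in x) * U n x).
Proof.
elim: n => [|n IH].
  apply/funext => x; rewrite [iter 0 _ _]/= expr0 mulr1 /U.
  rewrite -(fourier_inversion_moment inL2_moment_unchirp s0 x (inL2_chirp_mul f2)
    (olct_fourier_pair fg) ccontinuous_chirp_mul.1 ccontinuous_chirp_mul.2).
  have pK : conjc (chirp_in x) * chirp_in x = 1 by rewrite conjc_expi expiNK.
  rewrite /chirp_mul -/K.
  rewrite [X in _ = _ * X](_ : _ = (K%:C * olct_cst) *
    ((conjc (chirp_in x) * chirp_in x) * f x)); last by ring.
  by rewrite pK mul1r mulrA mulVf ?mul1r// mulf_neq0// olct_cst_neq0.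
rewrite iterS IH; apply/funext => x.
rewrite (Delta_chirp _ _ (cderives_ft_moment inL2_moment_unchirp s n)).
have -> : (0 +i* - s) = - (0 +i* s) by apply: complex_ext; rewrite /= ?oppr0.
rewrite exprSr /U; move: ((K%:C * olct_cst)^-1) (conjc _) (ft _ _ x) => k p z.
by ring.
Qed.

(** The factor [|s|^n] of the closed form combines with [v^n] into [|u / b|^n], since [s = - 1 / b];
    what remains, the modulus of [z] and the square root of [K], is free of [n]. *)
Lemma norm2_iter_Delta : exists2 k : R, 0 < k & forall n,
  inL 2 (iter n (Delta M) f) /\
  norm2 (iter n (Delta M) f) = k * norm2 (fun u => ((u / b) ^+ n)%:C * g u).
Proof.
pose z := (K%:C * olct_cst)^-1.
have z0 : z != 0 by rewrite invr_eq0 mulf_neq0// olct_cst_neq0.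
exists (normc z * Num.sqrt K).
  by apply: mulr_gt0; [rewrite lt0r normc_eq0 z0 normc_ge0|rewrite sqrtr_gt0].
move=> n; rewrite iter_Delta.
have U2 : inL 2 (U n) by exact: inL2_ft_moment inL2_moment_unchirp s s0 n.
split.
  apply/inL2Zl/(@inL2_bounded _ 1) => //.
    by apply: cmeasurableJ; exact: measurable_chirp_in.
  by move=> x; rewrite normcJ_real normc_chirp_in.
rewrite (@eq_norm2 _ _ (fun x => (z * (0 +i* s) ^+ n) * U n x)); last first.
  move=> x; rewrite -/z [LHS]Normc.normcM [RHS]Normc.normcM (Normc.normcM (conjc _)).
  by rewrite normcJ_real normc_chirp_in mul1r.
rewrite norm2Zl// (Normc.normcM z) normcX.
have -> : norm2 (U n) = Num.sqrt K * norm2 (moment G n).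
  apply/eqP; rewrite -(@eqrXn2 _ 2) ?norm2_ge0 ?mulr_ge0 ?sqrtr_ge0 ?norm2_ge0//.
  rewrite exprMn (sqr_sqrtr (ltW K_gt0)); apply/eqP.
  exact: (norm2_ft_moment inL2_moment_unchirp s0 n (inL2_chirp_mul f2)
    ccontinuous_chirp_mul.1 ccontinuous_chirp_mul.2 (olct_fourier_pair fg)).
rewrite (@eq_norm2 _ (fun u => ((u / b) ^+ n)%:C * g u)
  (fun u => (s ^+ n)%:C * moment G n u)); last first.
  move=> u; rewrite [LHS]Normc.normcM [RHS]Normc.normcM /moment Normc.normcM.
  rewrite /G /unchirp (Normc.normcM (conjc _)) normcJ_real normc_chirp_out mul1r.
  by rewrite !normc_real mulrA -normrM -exprMn !normrX /s mulNr normrN (mulrC u).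
rewrite norm2Zl; last exact: inL2_moment_unchirp.
rewrite normc_real normrX [normc (0 +i* s)]/= expr0n add0r sqrtr_sqr.
ring.
Qed.

End iterates.
End olct_fourier.

(** * Roots of weighted norms *)

Section nth_roots.
Context {R : realType}.
Implicit Types (x : nat -> R) (c t gamma : R).

Lemma cvg_powR_harmonic c : 0 < c -> c `^ n%:R^-1 @[n --> \oo] --> (1 : R).
Proof.
move=> c0; rewrite (_ : (fun n => _) = fun n : nat => expR (n%:R^-1 * ln c)); last first.
  by apply/funext => n; rewrite /powR gt_eqF.
rewrite -[X in _ --> X]expR0; apply: continuous_cvg; first exact: continuous_expR.
rewrite -[X in _ --> X](mul0r (ln c)); apply: cvgM; last exact: cvg_cst.
by rewrite -cvg_shiftS; exact: cvg_harmonic.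
Qed.

(** Index 0 is excluded because the exponent would then be the inverse of 0, which is 0. *)
Lemma powR_exprn_mul (n : nat) t c : (0 < n)%N -> 0 <= t -> 0 <= c ->
  (t ^+ n * c) `^ n%:R^-1 = t * c `^ n%:R^-1.
Proof.
move=> n0 t0 c0; rewrite powRM ?exprn_ge0// -powR_mulrn// -powRrM divff ?powRr1//.
by rewrite pnatr_eq0 -lt0n.
Qed.

Lemma ler_root_cvg x t c gamma : 0 <= t -> 0 < c -> (forall n, t ^+ n * c <= x n) ->
  x n `^ n%:R^-1 @[n --> \oo] --> gamma -> t <= gamma.
Proof.
move=> t0 c0 tx xg.
have tl : t * c `^ n%:R^-1 @[n --> \oo] --> t.
  by rewrite -[X in _ --> X]mulr1; apply: cvgM; [exact: cvg_cst|exact: cvg_powR_harmonic].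
apply: (ler_cvg_to tl xg); near=> n.
have n0 : (0 < n)%N by near: n; exact: nbhs_infty_gt.
rewrite -(powR_exprn_mul n0 t0 (ltW c0)).
have tc0 : 0 <= t ^+ n * c by rewrite mulr_ge0 ?exprn_ge0// ltW.
by apply: ge0_ler_powR; rewrite ?nnegrE ?invr_ge0// (le_trans tc0).
Unshelve. all: by end_near. Qed.

Lemma root_cvg x gamma (D : R) : 0 <= gamma -> 0 < D ->
  (forall n, 0 <= x n) -> (forall n, x n <= gamma ^+ n * D) ->
  (forall t, 0 <= t -> t < gamma -> exists2 c, 0 < c & forall n, t ^+ n * c <= x n) ->
  x n `^ n%:R^-1 @[n --> \oo] --> gamma.
Proof.
move=> g0 D0 x0 xD xt.
have up n : (0 < n)%N -> x n `^ n%:R^-1 <= gamma * D `^ n%:R^-1.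
  move=> n0; rewrite -(powR_exprn_mul n0 g0 (ltW D0)).
  by apply: ge0_ler_powR; rewrite ?nnegrE ?invr_ge0// (le_trans (x0 n)).
have upl : gamma * D `^ n%:R^-1 @[n --> \oo] --> gamma.
  by rewrite -[X in _ --> X]mulr1; apply: cvgM; [exact: cvg_cst|exact: cvg_powR_harmonic].
apply/cvgrPdist_le => e e0.
(* If [gamma <= e], nonnegativity of the roots is lower bound enough; otherwise [gamma - e / 2] is a
   nonnegative number below [gamma] to which the growth hypothesis applies. *)
have [ge|eg] := leP gamma e.
  have /cvgrPdist_le /(_ _ e0) H := upl.
  near=> n; have n0 : (0 < n)%N by near: n; exact: nbhs_infty_gt.
  have K1 : `|gamma - gamma * D `^ n%:R^-1| <= e by near: n; exact: H.
  rewrite ler_norml lerBrDr; apply/andP; split.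
    have := up n n0; move: K1; rewrite ler_norml => /andP[+ _]; lra.
  by have := powR_ge0 (x n) n%:R^-1; lra.
have t0 : 0 <= gamma - e / 2 by lra.
have tg : gamma - e / 2 < gamma by lra.
have [c c0 tx] := xt _ t0 tg.
have lowl : (gamma - e / 2) * c `^ n%:R^-1 @[n --> \oo] --> gamma - e / 2.
  by rewrite -[X in _ --> X]mulr1; apply: cvgM; [exact: cvg_cst|exact: cvg_powR_harmonic].
have e20 : 0 < e / 2 by rewrite divr_gt0.
have /cvgrPdist_le /(_ _ e0) H := upl.
have /cvgrPdist_le /(_ _ e20) H' := lowl.
near=> n; have n0 : (0 < n)%N by near: n; exact: nbhs_infty_gt.
have K1 : `|gamma - gamma * D `^ n%:R^-1| <= e by near: n; exact: H.
have K2 : `|gamma - e / 2 - (gamma - e / 2) * c `^ n%:R^-1| <= e / 2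
  by near: n; exact: H'.
have low : (gamma - e / 2) * c `^ n%:R^-1 <= x n `^ n%:R^-1.
  rewrite -(powR_exprn_mul n0 t0 (ltW c0)).
  have tc0 : 0 <= (gamma - e / 2) ^+ n * c by rewrite mulr_ge0 ?exprn_ge0// ltW.
  by apply: ge0_ler_powR; rewrite ?nnegrE ?invr_ge0// (le_trans tc0).
move: K1 K2; rewrite !ler_norml => /andP[h1 _] /andP[_ h2].
have K3 := up n n0; apply/andP; split; lra.
Unshelve. all: by end_near. Qed.

End nth_roots.

(** * Growth of the weighted norms *)

Section weighted_norms.
Context {R : realType}.
Let mu := @lebesgue_measure R.
Local Notation normc := Normc.normc.
Variables (b : R) (g : R -> R[i]).
Hypothesis g2 : inL 2 g.

Let weighted n : R -> R[i] := fun u => ((u / b) ^+ n)%:C * g u.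
Let radial u : R := if g u != 0 then `|u / b| else 0.

Lemma measurable_weighted n : cmeasurable (weighted n).
Proof.
apply: cmeasurableM; last exact: inL2_measurable.
by apply: cmeasurable_real; apply: measurable_funX; exact: measurable_funM.
Qed.

Lemma weighted_le (r : R) n : 0 <= r -> {ae mu, forall u, radial u <= r} ->
  inL 2 (weighted n) /\ norm2 (weighted n) <= r ^+ n * norm2 g.
Proof.
move=> r0 rr.
have mw := measurable_weighted n.
have mw2 : measurable_fun setT (fun u => (normc (weighted n u) ^+ 2)%:E).
  by apply/measurable_EFinP/measurable_funX; exact: measurable_normc.
have rg : inL 2 (fun u => (r ^+ n)%:C * g u) by exact: inL2Zl.
have le : (\int[mu]_u (normc (weighted n u) ^+ 2)%:E <=
    \int[mu]_u (normc ((r ^+ n)%:C * g u) ^+ 2)%:E)%E.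
  apply: ae_ge0_le_integral => //.
  - by move=> u _; rewrite lee_fin sqr_ge0.
  - by move=> u _; rewrite lee_fin sqr_ge0.
  - by apply/measurable_EFinP; exact: rintegrable_measurable (inL2_sqr rg).
  apply: filterS rr; first exact: (ae_filter_ringOfSetsType mu).
  move=> u ru _; rewrite lee_fin ler_sqr ?nnegrE ?normc_ge0//.
  move: ru; rewrite /weighted /radial !Normc.normcM !normc_real !normrX (ger0_norm r0).
  case: ifPn => [_ ru|/negPn/eqP -> _]; last by rewrite Normc.normc0 !mulr0.
  by rewrite ler_wpM2r ?normc_ge0// lerXn2r// nnegrE.
have w2 : inL 2 (weighted n).
  apply/inL2P; split=> //; apply/integrableP; split=> //.
  under eq_integral do rewrite /= ger0_norm ?sqr_ge0//.
  apply: le_lt_trans le _; have /(integrable_lty measurableT) := inL2_sqr rg.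
  by [].
split=> //; rewrite -[r ^+ n]ger0_norm ?exprn_ge0// -normc_real -norm2Zl//.
rewrite /norm2 ler_wsqrtr// -lee_fin !EFin_Rintegral//; exact: inL2_sqr.
Qed.

(** On [E], where [radial] exceeds [t], the weight is at least [t^n], so the constant is the L^2
    norm of [g] restricted to [E]. It is positive: as [t >= 0], [g] vanishes nowhere on [E], and [E]
    is not negligible. *)
Lemma weighted_ge (t : R) : 0 <= t -> ~ {ae mu, forall u, radial u <= t} ->
  exists2 c : R, 0 < c & forall n, inL 2 (weighted n) -> t ^+ n * c <= norm2 (weighted n).
Proof.
move=> t0 nrt.
pose E := [set u | t < radial u].
have mg : measurable_fun setT (fun u => normc (g u)).
  by apply: measurable_normc; exact: inL2_measurable.
have mrad : measurable_fun setT radial.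
  (* The modulus turns the complex test into one on a measurable real function. *)
  rewrite (_ : radial = fun u => if normc (g u) == 0 then 0 else `|u / b|); last first.
    by apply/funext => u; rewrite /radial normc_eq0; case: eqP.
  apply: measurable_fun_ifT => //.
    by apply: measurable_fun_eqr.
  by apply: measurableT_comp => //; exact: measurable_funM.
have mE : measurable E.
  rewrite (_ : E = setT `&` radial @^-1` `]t, +oo[%classic).
    by apply: mrad => //; exact: measurable_itv.
  by rewrite setTI; apply/seteqP; split=> u; rewrite /E /= in_itv/= andbT.
pose h u : R := normc (g u) ^+ 2 * \1_E u.
have h0 u : 0 <= h u by rewrite mulr_ge0 ?sqr_ge0.
have mh : measurable_fun setT h.
  by apply: measurable_funM; [exact: measurable_funX|exact: measurable_indic].
have ih : rintegrable h.
  apply: (le_rintegrable mh (inL2_sqr g2)) => u; rewrite ger0_norm// /h.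
  by rewrite ler_piMr ?sqr_ge0// indicE; case: (_ \in _).
have hpos : 0 < \int[mu]_u h u.
  rewrite lt_neqAle Rintegral_ge0// andbT eq_sym; apply/eqP => h00; apply: nrt.
  have mhE : measurable_fun setT (EFin \o h) by exact/measurable_EFinP.
  have : (\int[mu]_u `|(EFin \o h) u| = 0)%E.
    under eq_integral do rewrite /= ger0_norm//.
    by rewrite -EFin_Rintegral// h00.
  move=> /(ae_eq_integral_abs mu measurableT mhE) h0ae.
  apply: filterS h0ae.
  move=> u /(_ Logic.I) -[] /eqP; rewrite /h mulf_eq0 expf_eq0/= normc_eq0 => /orP[gu|].
    by rewrite /radial gu.
  by rewrite indicE pnatr_eq0 eqb0 notin_setE /E /= => /negP; rewrite -leNgt.
exists (Num.sqrt (\int[mu]_u h u)); first by rewrite sqrtr_gt0.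
move=> n w2; rewrite -(ger0_norm (exprn_ge0 n t0)) -sqrtr_sqr -sqrtrM ?sqr_ge0//.
rewrite ler_wsqrtr// -RintegralZl//; apply: le_Rintegral => //.
- exact: rintegrableZl.
- exact: inL2_sqr.
move=> u _; rewrite /h indicE; case: (boolP (u \in E)) => [|_]; last first.
  by rewrite !mulr0 sqr_ge0.
rewrite inE mulr1 /weighted Normc.normcM normc_real exprMn => tu.
rewrite ler_wpM2r ?sqr_ge0// ler_sqr ?nnegrE ?exprn_ge0// normrX.
rewrite lerXn2r ?nnegrE// ltW// (lt_le_trans tu)// /radial.
by case: ifPn.
Qed.

End weighted_norms.

(** * The essential radius as the limit of the roots *)

Section spectral_radius.
Context {R : realType}.
Let mu := @lebesgue_measure R.
Local Notation normc := Normc.normc.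
Variable M : olct_param R.
Local Notation b := (pb M).
Variables f g : R -> R[i].
Hypotheses (b0 : b != 0) (f2 : inL 2 f) (cf : ccontinuous f) (fg : is_olct M f g).
Let N n := norm2 (fun u => ((u / b) ^+ n)%:C * g u).

(** This rests on the line having positive measure; it excludes the value [-oo] in the final case
    analysis. *)
Lemma olct_radius_ge0 : (0 <= olct_radius M g)%E.
Proof.
have muT : (0 < mu setT)%E.
  by rewrite -set_itvNyy /mu lebesgue_measure_itv/= addye// ltry.
apply: ess_sup_gee; first exact: muT.
by apply: aeW => u; rewrite lee_fin; case: ifP.
Qed.

Lemma Delta_norm_root (k : R) n : inL 2 (iter n (Delta M) f) ->
  norm2 (iter n (Delta M) f) = k * N n ->
  (LnormC 2 (iter n (Delta M) f) `^ n%:R^-1 = ((k * N n) `^ n%:R^-1)%:E)%E.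
Proof. by move=> /LnormC_norm2 -> ->. Qed.

(** A finite radius bounds the weight almost everywhere, which puts all weighted functions in L^2
    and bounds the roots above; each [t < r] is exceeded on a non-negligible set, which bounds them
    below. *)
Lemma olct_radius_cvg (r : R) : olct_radius M g = r%:E ->
  [/\ forall n, inL 2 (iter n (Delta M) f),
      forall n, inL 2 (fun u => ((u / b) ^+ n)%:C * g u) &
      (LnormC 2 (iter n (Delta M) f) `^ n%:R^-1)%E @[n --> \oo] --> r%:E].
Proof.
move=> rE; have g2 : inL 2 g by case: fg.
have r0 : 0 <= r by rewrite -lee_fin -rE olct_radius_ge0.
have rr : {ae mu, forall u, (if g u != 0 then `|u / b| else 0) <= r}.
  have : (olct_radius M g <= r%:E)%E by rewrite rE.
  by move=> /ess_supP; apply: filterS => u; rewrite lee_fin.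
have w2 n := (weighted_le g2 n r0 rr).1.
have wr n : N n <= r ^+ n * norm2 g := (weighted_le g2 n r0 rr).2.
have [k k0 kP] := norm2_iter_Delta b0 f2 cf fg w2.
split=> [n|//|]; first exact: (kP n).1.
under eq_fun => n do rewrite (Delta_norm_root (kP n).1 (kP n).2).
apply: cvg_EFin; first exact: nearW.
rewrite /comp /=.
(* The 1 keeps the constant positive when [g] vanishes almost everywhere. *)
apply: (@root_cvg _ (fun n => k * N n) r (k * norm2 g + 1)) => //.
- by rewrite ltr_wpDl// mulr_ge0 ?norm2_ge0// ltW.
- by move=> n; rewrite mulr_ge0 ?norm2_ge0// ltW.
- move=> n; apply: (@le_trans _ _ (r ^+ n * (k * norm2 g))).
    by rewrite mulrCA ler_wpM2l// ltW.
  by rewrite ler_wpM2l ?exprn_ge0// lerDl.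
move=> t t0 tr.
have [|c c0 cP] := weighted_ge (b := b) g2 t0.
  move=> tae; have : (olct_radius M g <= t%:E)%E.
    apply/ess_supP; apply: filterS tae; first exact: (ae_filter_ringOfSetsType mu).
    by move=> u; rewrite lee_fin.
  by rewrite rE lee_fin leNgt tr.
exists (k * c); first exact: mulr_gt0.
by move=> n; rewrite mulrCA ler_wpM2l ?(ltW k0)//; exact: cP.
Qed.

(** If the weight exceeded [r + e] on a non-negligible part of the set where [g] is nonzero, the
    norms would grow at least like [(r + e)^n], and the limit of their roots could not be [r].
    Finiteness of the radius is thereby a conclusion. *)
Lemma olct_radius_le (r : R) :
  (forall n, inL 2 (fun u => ((u / b) ^+ n)%:C * g u)) ->
  (LnormC 2 (iter n (Delta M) f) `^ n%:R^-1)%E @[n --> \oo] --> r%:E ->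
  (olct_radius M g <= r%:E)%E.
Proof.
move=> w2 Ar; have g2 : inL 2 g by case: fg.
have [k k0 kP] := norm2_iter_Delta b0 f2 cf fg w2.
move: Ar; under eq_fun => n do rewrite (Delta_norm_root (kP n).1 (kP n).2).
move=> /fine_cvgP[_]; rewrite /comp /= => Ar.
have r0 : 0 <= r.
  by apply: (ler_cvg_to (cvg_cst 0) Ar); apply: nearW => n; exact: powR_ge0.
apply/lee_addgt0Pr => e e0; rewrite -EFinD.
apply/ess_supP.
have [rae|nae] := pselect {ae mu, forall u, (if g u != 0 then `|u / b| else 0) <= r + e}.
  apply: filterS rae; first exact: (ae_filter_ringOfSetsType mu).
  by move=> u; rewrite lee_fin.
have re0 : 0 <= r + e by rewrite addr_ge0// ltW.
have [c c0 cP] := weighted_ge g2 re0 nae.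
have : r + e <= r.
  apply: (ler_root_cvg re0 (mulr_gt0 k0 c0) _ Ar) => n.
  by rewrite mulrCA ler_wpM2l ?(ltW k0)//; exact: cP.
by rewrite gerDl leNgt e0.
Qed.

(** Outside the interval every point lies in the open set [r |b| < |x|], on which [g] vanishes
    almost everywhere. *)
Lemma ess_support_olct (r : R) : olct_radius M g = r%:E ->
  ess_support g `<=` `[- (r * `|b|), r * `|b|].
Proof.
move=> rE u gu; rewrite /= in_itv/= -ler_norml leNgt; apply/negP => ru.
apply: (gu [set x | r * `|b| < `|x|]).
  have : open [set x : R | r * `|b| < `|x|].
    rewrite (_ : [set x | _] = Num.norm @^-1` [set y : R | r * `|b| < y])//.
    by apply: open_comp; [move=> x _; exact: norm_continuous|exact: open_gt].
  by rewrite openE; exact.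
have : (olct_radius M g <= r%:E)%E by rewrite rE.
move=> /ess_supP; apply: filterS => x; rewrite lee_fin; case: eqP => //= _.
by rewrite normrM normfV ler_pdivrMr ?normr_gt0// leNgt => /negbTE ->.
Qed.

End spectral_radius.

Theorem theorem4p2 (R : realType) (a b c d u0 w0 : R) (b_neq0 : b != 0)
    (f : R -> R[i]) (f_L2 : inL 2 f) (f_smooth : smooth f)
    (g : R -> R[i]) (gE : is_olct (OLCTParam a b c d u0 w0) f g) (gamma : R) :
  (olct_radius (OLCTParam a b c d u0 w0) g = gamma%:E /\
   ess_support g `<=` `[- (gamma * `|b|), gamma * `|b|])
  <->
  ((forall n : nat, inL 2 (iter n (Delta (OLCTParam a b c d u0 w0)) f)) /\
   (forall n : nat, inL 2 (fun u => ((u / b) ^+ n)%:C * g u)) /\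
   (LnormC 2 (iter n (Delta (OLCTParam a b c d u0 w0)) f) `^ (n%:R^-1))%E
     @[n --> \oo] --> gamma%:E).
Proof.
have cf : ccontinuous f.
  by split=> x; have [df dg] := f_smooth 0%N x; apply: differentiable_continuous;
    exact/derivable1_diffP.
set M := OLCTParam a b c d u0 w0.
have b0 : pb M != 0 by [].
split=> [[gammaE _]|[D2 [w2 Dgamma]]].
  by have [] := olct_radius_cvg b0 f_L2 cf gE gammaE.
(* With the lower bound 0 this leaves a real radius [r]; the direct part shows that the roots tend
   to [r], so [r = gamma] by uniqueness of the limit. *)
have : (olct_radius M g <= gamma%:E)%E by exact: (olct_radius_le b0 f_L2 cf gE).
have := olct_radius_ge0 M g.
case E : (olct_radius M g) => [r| |]// _ _.
have [_ _ Dr] := olct_radius_cvg b0 f_L2 cf gE E.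
have rg : olct_radius M g = gamma%:E by rewrite E; exact: (cvg_unique _ Dr Dgamma).
by split; [rewrite -E|exact: (ess_support_olct b0 rg)].
Qed.
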